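(* Let $a,c$ be real numbers with $-1<a<1$, $a\neq 0$ and $c\neq 0,-1,-2,\ldots$, and let $\mathcal F=(F_1,F_2)$ be a pair of finite sets of positive integers (not both empty) such that $\Omega_{\mathcal F}^{a,c}(n)\neq 0$ for all nonnegative integers $n$. Then the polynomials $m_n^{a,c;\mathcal F}$, $n\in\sigma_{\mathcal F}$, are orthogonal with respect to the (possibly signed) discrete measure $$\omega_{a,c}^{\mathcal F}=\sum_{x=0}^\infty\frac{a^x\,\Gamma(x+c+k)}{x!\,\Omega_{\mathcal F}^{a,c}(x)\,\Omega_{\mathcal F}^{a,c}(x+1)}\,\delta_x ,$$ i.e. $\int m_n^{a,c;\mathcal F}m_r^{a,c;\mathcal F}\,d\omega_{a,c}^{\mathcal F}=0$ for $n\ne r$, $n,r\in\sigma_{\mathcal F}$. Moreover, for $-1<a<0$ the measure $\omega_{a,c}^{\mathcal F}$ is never positive, and for $0<a<1$ the measure $\omega_{a,c}^{\mathcal F}$ is positive if and only if $c$ and $\mathcal F$ are admissible.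
   Context: $\mathbb N=\{0,1,2,\ldots\}$; $(y)_j=y(y+1)\cdots(y+j-1)$, $(y)_0=1$; $\delta_x$ is the Dirac mass at $x$. Meixner polynomials: for $a\ne 0,1$, $m_n^{a,c}(x)=\frac{a^n}{(1-a)^n}\sum_{j=0}^n a^{-j}\binom{x}{j}\binom{-x-c}{n-j}$. For a pair $\mathcal F=(F_1,F_2)$ of finite sets of positive integers, let $k_i=|F_i|$, $k=k_1+k_2$, $$u_{\mathcal F}=\sum_{f\in F_1}f+\sum_{f\in F_2}f-\binom{k_1+1}{2}-\binom{k_2}{2},\qquad \sigma_{\mathcal F}=\{u_{\mathcal F},u_{\mathcal F}+1,\ldots\}\setminus\{u_{\mathcal F}+f: f\in F_1\}.$$ For $n\in\sigma_{\mathcal F}$, $m_n^{a,c;\mathcal F}(x)$ is the determinant of the $(k+1)\times(k+1)$ matrix with columns indexed by $j=0,1,\ldots,k$ whose rows are, from top to bottom: the row $\big(m_{n-u_{\mathcal F}}^{a,c}(x+j)\big)_j$; then, for each $f\in F_1$ in increasing order, the row $\big(m_f^{a,c}(x+j)\big)_j$; then, for each $f\in F_2$ in increasing order, the row $\big(m_f^{1/a,c}(x+j)/a^j\big)_j$. $\Omega_{\mathcal F}^{a,c}(x)$ is the determinant of the $k\times k$ matrix with columns indexed by $j=0,1,\ldots,k-1$ whose rows are $\big(m_f^{a,c}(x+j)\big)_j$ for $f\in F_1$ (increasing order), followed by $\big(m_f^{1/a,c}(x+j)/a^j\big)_j$ for $f\in F_2$ (increasing order). Admissibility: for $c\neq 0,-1,-2,\ldots$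 put $\hat c=\max\{-[c],0\}$, where $[c]$ is the integral part (floor) of $c$. The number $c$ and the pair $\mathcal F$ are admissible if for all $x\in\mathbb N$ $$\frac{\prod_{f\in F_1}(x-f)\prod_{f\in F_2}(x+c+f)}{(x+c)_{\hat c}}\ge 0 .$$ *)

(* Defs.v *)
From HB Require Import structures.
From mathcomp Require Import all_boot all_order all_algebra finmap.
From mathcomp Require Import all_classical all_reals all_analysis.
Import Order.TTheory GRing.Theory Num.Theory.
Import numFieldNormedType.Exports.

Set Implicit Arguments.
Unset Strict Implicit.
Unset Printing Implicit Defensive.

Local Open Scope classical_set_scope.
Local Open Scope ring_scope.

Section SpecialFunctions.
Variable R : realType.
Implicit Types a c x y z : R.

Definition pochhammer y (j : nat) : R := \prod_(i < j) (y + i%:R).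

Definition gbinom x (j : nat) : R := (\prod_(i < j) (x - i%:R)) / (j`!)%:R.

(* max {- [c], 0}; when c is not in {0, -1, -2, ...}, this is the least m with
   c + m > 0. *)
Definition hat c : nat := `|Num.max (- Num.floor c) 0|%N.

Definition euler_gamma z : R :=
  \int[lebesgue_measure]_(t in `]0, +oo[) (t `^ (z - 1) * expR (- t)).

(* Gamma on R \ {0, -1, -2, ...}: Euler's integral for z > 0, extended to
   z < 0 by Gamma(z) = Gamma(z + m) / (z)_m with z + m > 0.
   The values at the poles are irrelevant. *)
Definition Gamma z : R := euler_gamma (z + (hat z)%:R) / pochhammer z (hat z).

Definition meixner a c (n : nat) x : R :=
  a ^+ n / (1 - a) ^+ n *
  \sum_(j < n.+1) a ^- j * gbinom x j * gbinom (- x - c) (n - j).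

End SpecialFunctions.

Section ExceptionalMeixner.
Variables (R : realType) (a c : R) (F1 F2 : {fset nat}).

Definition nF : nat := (#|` F1| + #|` F2|)%N.

(* For sets of positive integers the truncated subtractions are exact:
   \sum_(f in F1) f >= 'C(#|F1| + 1, 2) and \sum_(f in F2) f >= 'C(#|F2|, 2). *)
Definition uF : nat :=
  (\sum_(f <- enum_fset F1) f + \sum_(f <- enum_fset F2) f
   - 'C((#|` F1|).+1, 2) - 'C(#|` F2|, 2))%N.

Definition sigmaF : pred nat :=
  fun n => (uF <= n)%N && ((n - uF)%N \notin F1).

Definition F_rows (x : R) : seq (nat -> R) :=
  [seq (fun j : nat => meixner a c f (x + j%:R))
     | f <- sort leq (enum_fset F1)] ++
  [seq (fun j : nat => meixner a^-1 c f (x + j%:R) / a ^+ j)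
     | f <- sort leq (enum_fset F2)].

Definition det_rows (s : seq (nat -> R)) : R :=
  \det (\matrix_(i < size s, j < size s) nth (fun=> 0) s i j).

Definition OmegaF (x : R) : R := det_rows (F_rows x).

Definition meixnerF (n : nat) (x : R) : R :=
  det_rows ((fun j : nat => meixner a c (n - uF) (x + j%:R)) :: F_rows x).

Definition admissible : Prop :=
  forall x : nat,
    0 <= (\prod_(f <- enum_fset F1) (x%:R - f%:R)
          * \prod_(f <- enum_fset F2) (x%:R + c + f%:R))
         / pochhammer (x%:R + c) (hat c).

Definition massF (x : nat) : R :=
  a ^+ x * Gamma (x%:R + c + nF%:R) /
  ((x`!)%:R * OmegaF x%:R * OmegaF (x%:R + 1)).

End ExceptionalMeixner.

(* The signed measure \sum_x w x * delta_x on R, w of arbitrary sign, handled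
   through its Jordan decomposition: the measures [dpos w] and [dneg w] carry
   the positive and the negative masses, so they have disjoint supports. *)
Section SignedDiscreteMeasure.
Variables (R : realType) (w : nat -> R).

Lemma posmass_subproof (v : R) : 0 <= Num.max v 0.
Proof. by rewrite le_max lexx orbT. Qed.

Definition dpos : {measure set (measurableTypeR R) -> \bar R} :=
  mseries (fun x : nat => mscale (NngNum (posmass_subproof (w x)))
                                 (dirac (x%:R : measurableTypeR R))) 0.

Definition dneg : {measure set (measurableTypeR R) -> \bar R} :=
  mseries (fun x : nat => mscale (NngNum (posmass_subproof (- w x)))
                                 (dirac (x%:R : measurableTypeR R))) 0.

Definition dsigned (A : set (measurableTypeR R)) : \bar R :=
  (dpos A - dneg A)%E.

(* The total variation is finite; in particular [dsigned] never takes the form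
   oo - oo. *)
Definition dfinite : Prop :=
  (dpos [set: measurableTypeR R] < +oo)%E /\
  (dneg [set: measurableTypeR R] < +oo)%E.

Definition dintegrable (f : R -> R) : Prop :=
  dpos.-integrable [set: measurableTypeR R] (EFin \o f) /\
  dneg.-integrable [set: measurableTypeR R] (EFin \o f).

Definition dintegral (f : R -> R) : R :=
  \int[dpos]_(x in [set: measurableTypeR R]) f x
  - \int[dneg]_(x in [set: measurableTypeR R]) f x.

End SignedDiscreteMeasure.

(* Main.v *)
Require Import Defs.
From HB Require Import structures.
From mathcomp Require Import all_boot all_order all_algebra finmap.
From mathcomp Require Import all_classical all_reals all_analysis.
From mathcomp Require Import measurable_realfun ring lra zify.
From mathcomp Require polyrcf.
Import Order.TTheory GRing.Theory Num.Theory.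
Import numFieldNormedType.Exports.

Set Implicit Arguments.
Unset Strict Implicit.
Unset Printing Implicit Defensive.

Local Open Scope classical_set_scope.
Local Open Scope ring_scope.

(** For x a natural number, m_n^{a,c}(x) is up to a constant P_x(n), where P_x
    is a polynomial of degree x in the index, and m_f^{1/a,c}(x) is up to a
    constant a^x P_x(-c-f).  The P_x are orthogonal for the Meixner functional
    L, normalized by L(s(s-1)...(s-j+1)) = a^j (c)_j / (1-a)^j.  Hence
    Omega(x) and m_n^{a,c;F}(x) are the determinants of Christoffel's formula
    for the polynomials q_x orthogonal for L(rho .), where
    rho(s) = prod_{F_1} (s - f) prod_{F_2} (s + c + f), and the mass at x is a
    power of a times Gamma(c) / L(rho q_x^2), up to a constant.  Orthogonality
    is the vanishing in the limit of the boundary term in the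
    Christoffel-Darboux formula for the q_x.  For 0 < a < 1, positivity of the
    masses amounts to Gamma(c) L(rho p^2) >= 0 for all p, while
    Gamma(c) L(rho p^2) is a positive multiple of
    sum_s a^s Gamma(s + c) rho(s) p(s)^2 / s!; letting p concentrate at one
    point s shows that Gamma(s + c) rho(s) >= 0, which is admissibility.  For
    a < 0 the masses eventually alternate in sign. *)

(** * Orthogonal polynomials for a linear functional *)

Section Functional.
Variable F : fieldType.

(** The algebra rests on a linear functional given by its factorial moments, not on a measure: for
    negative c the weight a^s (c)_s / s! changes sign, while the moments make sense for every
    regular c. The series enters only for the sign of the masses, where it equals L times its total
    mass (1 - a)^(-c) > 0. The nonvanishing of Omega acts twice: it gives q_x exact degree x and
    nonzero norm, and, Omega being a polynomial, it keeps |Omega(n)| away from 0, so that 1/Omega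
    cannot spoil the decay of a^N. The delicate step is the concentration of p at a point s0. The
    weight is dominated by C a'^s with a < a' < 1, a Meixner weight with parameter c = 1, whose
    reproducing kernel at s0 is explicit. Since P_x(s) = P_s(x), the kernel's value at s0 is a
    partial sum of the squared norm of P_{s0}; its limit is therefore known, and it is the value for
    which the kernel concentrates at s0. This takes the place of a determinacy argument. The nodes
    -c - f of F_2 come from the Pfaff transformation, which trades 1/a for a at the price of the
    reflection y -> -c - y. *)

Definition functional (L : {poly F} -> F) :=
  forall a p q, L (a *: p + q) = a * L p + L q.

Variables (L : {poly F} -> F) (linL : functional L).

Lemma functional0 : L 0 = 0.
Proof.
have := linL (-1) 0 0; rewrite scaler0 addr0 mulN1r addNr; exact.
Qed.

Lemma functionalZ a p : L (a *: p) = a * L p.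
Proof. by rewrite -[a *: p]addr0 linL functional0 addr0. Qed.

Lemma functionalD p q : L (p + q) = L p + L q.
Proof. by rewrite -[p]scale1r linL mul1r scale1r. Qed.

Lemma functionalB p q : L (p - q) = L p - L q.
Proof. by rewrite functionalD -scaleN1r functionalZ mulN1r. Qed.

Lemma functional_sum (I : Type) (r : seq I) (P : pred I) (f : I -> {poly F}) :
  L (\sum_(i <- r | P i) f i) = \sum_(i <- r | P i) L (f i).
Proof. exact: (big_morph L functionalD functional0). Qed.

Lemma functional_mul (rho : {poly F}) : functional (fun p => L (rho * p)).
Proof. by move=> a p q; rewrite mulrDr -scalerAr linL. Qed.

Lemma functional_scale (b : F) : functional (fun p => b * L p).
Proof. by move=> a p q; rewrite linL mulrDr mulrCA. Qed.

End Functional.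

Section FunctionalOnBasis.
Variables (F : fieldType) (b : nat -> {poly F}) (mu : nat -> F).
Hypothesis size_b : forall n, size (b n) = n.+1.

(** The values on [1], ['X], ..., ['X^(n-1)], found by solving the triangular system
    [L (b m) = mu m] for its leading power. Carrying the whole list gives the recursion access to
    all earlier values. *)
Fixpoint basis_moments n : seq F :=
  if n is m.+1 then
    let s := basis_moments m in
    rcons s ((mu m - \sum_(i < m) (b m)`_i * s`_i) / (b m)`_m)
  else [::].

Lemma size_basis_moments n : size (basis_moments n) = n.
Proof. by elim: n => //= n IH; rewrite size_rcons IH. Qed.

Lemma nth_basis_moments n i : (i < n)%N ->
  (basis_moments n)`_i = (basis_moments i.+1)`_i.
Proof.
elim: n => // n IH; rewrite ltnS leq_eqVlt => /orP[/eqP->//|ltin].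
by rewrite /= nth_rcons size_basis_moments ltin IH.
Qed.

Lemma exists_functional_on_basis :
  exists2 L : {poly F} -> F, functional L & forall n, L (b n) = mu n.
Proof.
pose M i := (basis_moments i.+1)`_i.
pose L p : F := \sum_(i < size p) p`_i * M i.
(* Linearity compares polynomials of different sizes, so all three sums are brought to a common
   length. *)
have LE p n : (size p <= n)%N -> L p = \sum_(i < n) p`_i * M i.
  move=> sp; rewrite /L (big_ord_widen _ (fun i => p`_i * M i) sp).
  rewrite big_mkcond /=; apply: eq_bigr => i _; case: ltnP => // ?.
  by rewrite nth_default ?mul0r.
exists L => [a p q|n].
  pose n := maxn (size (a *: p + q)) (maxn (size p) (size q)).
  rewrite !(@LE _ n) ?leq_max ?leqnn ?orbT // mulr_sumr -big_split /=.
  by apply: eq_bigr => i _; rewrite coefD coefZ mulrDl mulrA.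
rewrite /L size_b big_ord_recr /= {2}/M /= nth_rcons size_basis_moments.
have bn0 : (b n)`_n != 0.
  have := lead_coef_eq0 (b n); rewrite lead_coefE size_b /= => ->.
  by rewrite -size_poly_eq0 size_b.
rewrite ltnn eqxx mulrC divfK //.
rewrite addrC -addrA [X in _ + X]addrC [X in _ + X](_ : _ = 0) ?addr0 //.
apply/eqP; rewrite subr_eq0; apply/eqP; apply: eq_bigr => i _.
by rewrite (nth_basis_moments (ltn_ord i)).
Qed.

End FunctionalOnBasis.

Section OrthogonalPolynomials.
Variables (F : fieldType) (L : {poly F} -> F) (q : nat -> {poly F}).
Hypothesis linL : functional L.
Hypothesis size_q : forall n, size (q n) = n.+1.

Let lead_q n : (q n)`_n = lead_coef (q n).
Proof. by rewrite lead_coefE size_q. Qed.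

Lemma lead_coef_graded n : lead_coef (q n) != 0.
Proof. by rewrite lead_coef_eq0 -size_poly_eq0 size_q. Qed.

(** The step of every induction on the degree below: cancel the coefficient of index [m], which may
    itself be 0. *)
Lemma graded_split m (r : {poly F}) : (size r <= m.+1)%N ->
  (size (r - (r`_m / lead_coef (q m)) *: q m)%R <= m)%N.
Proof.
move=> sr; apply/leq_sizeP => j; rewrite coefB coefZ leq_eqVlt.
case/orP=> [/eqP<-|ltmj].
  by rewrite lead_q divfK ?lead_coef_graded ?subrr.
by rewrite (nth_default 0 (leq_trans sr ltmj)) [(q m)`__]nth_default ?size_q // mulr0 subr0.
Qed.

Section Favard.
Variables alpha beta gamma : nat -> F.
Hypothesis recq : forall n,
  'X * q n = alpha n *: q n.+1 + beta n *: q n + gamma n *: q n.-1.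
Hypothesis Lq : forall n, L (q n.+1) = 0.

(** The factors of ['X^m] are moved one by one onto [q k]. The recurrence lowers the index by at
    most one each time, so for [m < k] the indices are still positive when the power is used up, and
    [Lq] applies. *)
Lemma favard_orth n (r : {poly F}) : (size r <= n)%N -> L (q n * r) = 0.
Proof.
move=> sr; suff XL m k : (m < k)%N -> L (q k * 'X^m) = 0.
  rewrite -[r]coefK poly_def mulr_sumr functional_sum // big1 // => i _.
  by rewrite -scalerAr functionalZ // XL ?mulr0 // (leq_trans _ sr).
elim: m k => [[//|k] _|m IH k ltmk]; first by rewrite mulr1.
rewrite exprS mulrA [_ * 'X]mulrC recq !mulrDl -!scalerAl.
rewrite !functionalD // !functionalZ //.
by rewrite !IH ?mulr0 ?addr0 //; lia.
Qed.

(** Both sides are L(X q_n q_{n+1}), with the recurrence applied either to q_n or to q_{n+1}. *)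
Lemma favard_norm n :
  alpha n * L (q n.+1 * q n.+1) = gamma n.+1 * L (q n * q n).
Proof.
have o k (r : {poly F}) : (size r <= k)%N -> L (q k * r) = 0 by exact: favard_orth.
transitivity (L (q n.+1 * ('X * q n))).
  rewrite recq !mulrDr -!scalerAr !functionalD // !functionalZ //.
  by rewrite (o _ (q n)) ?size_q // (o _ (q n.-1)) ?size_q ?mulr0 ?addr0 //; lia.
rewrite mulrA [_ * 'X]mulrC recq !mulrDl -!scalerAl.
rewrite !functionalD // !functionalZ //.
by rewrite (o n.+2) ?(o n.+1) ?size_q // !mulr0 !add0r.
Qed.

End Favard.

Hypothesis orth : forall n (r : {poly F}), (size r <= n)%N -> L (q n * r) = 0.
Let N n := L (q n * q n).
Hypothesis N_neq0 : forall n, N n != 0.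

Lemma orth_coef n (r : {poly F}) : (size r <= n.+1)%N ->
  L (q n * r) = r`_n / lead_coef (q n) * N n.
Proof.
move=> sr; have /orth := graded_split sr.
rewrite mulrBr -scalerAr functionalB // functionalZ // => /eqP.
by rewrite subr_eq0 => /eqP.
Qed.

Lemma orth_eq0 n (r : {poly F}) : (size r <= n)%N ->
  (forall i, (i < n)%N -> L (q i * r) = 0) -> r = 0.
Proof.
elim: n r => [|n IH] r; first by rewrite leqn0 size_poly_eq0 => /eqP.
move=> sr h; apply: IH => [|i ltin]; last by apply: h; lia.
have := h n (leqnn _); rewrite orth_coef // => /eqP.
rewrite mulf_eq0 (negPf (N_neq0 _)) orbF mulf_eq0 invr_eq0.
rewrite (negPf (lead_coef_graded _)) orbF => /eqP rn0.
apply/leq_sizeP => j; rewrite leq_eqVlt => /orP[/eqP<-//|ltnj].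
by rewrite nth_default // (leq_trans sr).
Qed.

Let alpha n := lead_coef (q n) / lead_coef (q n.+1).

(** The outer coefficients are explicit because they drive the telescoping in Christoffel-Darboux;
    [beta] cancels there and stays existential. The case [n = 0] sets the last coefficient to 0, as
    [q n.-1] is then [q 0]. *)
Lemma three_term n : exists beta, 'X * q n =
  alpha n *: q n.+1 + beta *: q n +
  (if n is m.+1 then alpha m * N n / N m else 0) *: q n.-1.
Proof.
pose g := if n is m.+1 then alpha m * N n / N m else 0.
pose beta := L (q n * ('X * q n)) / N n; exists beta; rewrite -/g.
apply/eqP; rewrite -subr_eq0; apply/eqP.
have szX m : size ('X * q m) = m.+2.
  by rewrite mulrC size_mulX ?size_q // -size_poly_eq0 size_q.
apply: (@orth_eq0 n.+1) => [|i].
  have -> : alpha n = ('X * q n)`_n.+1 / lead_coef (q n.+1).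
    by rewrite coefXM /= lead_q.
  have := @graded_split n.+1 ('X * q n); rewrite szX => /(_ (leqnn _)) h.
  rewrite -addrA opprD addrA (leq_trans (size_polyD _ _)) // geq_max h size_polyN.
  rewrite (leq_trans (size_polyD _ _)) // geq_max.
  by rewrite !(leq_trans (size_scale_leq _ _)) ?size_q //; lia.
rewrite ltnS => lein; rewrite mulrBr !mulrDr -!scalerAr functionalB //.
rewrite !functionalD // !functionalZ // [q i * q n.+1]mulrC (@orth n.+1) ?size_q //.
rewrite mulr0 add0r.
move: lein; rewrite leq_eqVlt => /orP[/eqP->|ltin].
  rewrite /beta divfK //; case: n @g @beta => [|n] g beta.
    by rewrite /g mul0r addr0 subrr.
  by rewrite /= [L (q n.+1 * q n)]orth ?size_q // mulr0 addr0 subrr.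
rewrite [q i * q n]mulrC [L (q n * q i)]orth ?size_q // mulr0 add0r.
case: n @g @beta ltin => // n g beta; rewrite ltnS => lein /=.
(* Multiplication by X is symmetric for L, so only [i = n] leaves a top coefficient; this forces the
   value of the last coefficient. *)
have -> : q i * ('X * q n.+1) = q n.+1 * ('X * q i).
  by rewrite mulrCA [q i * _]mulrC mulrCA.
rewrite orth_coef ?szX // coefXM /=.
move: lein; rewrite leq_eqVlt => /orP[/eqP->|ltin].
  by rewrite lead_q /g /alpha -/(N n) divfK // subrr.
rewrite [q i * _]mulrC [L (q n * q i)]orth ?size_q // mulr0 subr0.
by rewrite nth_default ?size_q // mul0r mul0r.
Qed.

Lemma christoffel_darboux n (s t : F) :
  (s - t) * \sum_(x < n.+1) (q x).[s] * (q x).[t] / N x =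
  alpha n / N n * ((q n.+1).[s] * (q n).[t] - (q n).[s] * (q n.+1).[t]).
Proof.
have step m u : exists beta, u * (q m).[u] = alpha m * (q m.+1).[u] +
    beta * (q m).[u] +
    (if m is k.+1 then alpha k * N m / N k else 0) * (q m.-1).[u].
  have [b /(congr1 (fun p => p.[u]))] := three_term m.
  by rewrite !hornerE => h; exists b.
(* One [beta] must serve both s and t, so that its two contributions cancel. *)
have step2 m : exists beta, forall u, u * (q m).[u] = alpha m * (q m.+1).[u] +
    beta * (q m).[u] +
    (if m is k.+1 then alpha k * N m / N k else 0) * (q m.-1).[u].
  have [b hb] := three_term m; exists b => u.
  by move: hb => /(congr1 (fun p => p.[u])); rewrite !hornerE.
elim: n => [|n IH].
  rewrite big_ord_recr big_ord0 /= add0r; have [b hb] := step2 0%N.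
  have := hb s; have := hb t => /= ht hs.
  have -> : (s - t) * ((q 0).[s] * (q 0).[t] / N 0) =
    ((s * (q 0).[s]) * (q 0).[t] - (q 0).[s] * (t * (q 0).[t])) / N 0 by ring.
  by rewrite hs ht; ring.
rewrite big_ord_recr /= mulrDr IH; have [b hb] := step2 n.+1.
have := hb s; have := hb t => /= ht hs.
have -> : (s - t) * ((q n.+1).[s] * (q n.+1).[t] / N n.+1) =
  ((s * (q n.+1).[s]) * (q n.+1).[t] - (q n.+1).[s] * (t * (q n.+1).[t])) / N n.+1
  by ring.
rewrite hs ht; have := N_neq0 n; have := N_neq0 n.+1 => h1 h0; field.
by rewrite h0 h1.
Qed.

End OrthogonalPolynomials.

(** The q_n diagonalize the quadratic form p -> L(p^2): splitting off the top component leaves no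
    cross terms. *)
Lemma orth_sqr_ge0 (R : realFieldType) (L : {poly R} -> R) (q : nat -> {poly R}) :
  functional L -> (forall n, size (q n) = n.+1) ->
  (forall n (r : {poly R}), (size r <= n)%N -> L (q n * r) = 0) ->
  (forall n, 0 <= L (q n * q n)) -> forall p, 0 <= L (p * p).
Proof.
move=> linL size_q orth N_ge0 p; have [n /ltnW] := ubnP (size p).
elim: n p => [|n IH] p.
  by rewrite leqn0 size_poly_eq0 => /eqP->; rewrite mulr0 functional0.
move=> /(graded_split size_q) sr.
have [c [r [-> {}sr]]] : exists c r, p = c *: q n + r /\ (size r <= n)%N.
  by exists (p`_n / lead_coef (q n)), (p - (p`_n / lead_coef (q n)) *: q n);
    rewrite [_ + (p - _)]addrC subrK.
rewrite mulrDl !mulrDr -!scalerAl -!scalerAr !functionalD // !functionalZ //.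
rewrite [r * q n]mulrC [L (q n * r)]orth // !mulr0 !(addr0, add0r) addr_ge0 ?IH //.
by rewrite mulrA mulr_ge0 // -expr2 sqr_ge0.
Qed.

(** * The Christoffel transformation *)

Section DetRows.
Variable R : realType.
Implicit Types (s rs : seq (nat -> R)).

Lemma det_rowsE n s : size s = n ->
  det_rows s = \det (\matrix_(i < n, j < n) nth (fun=> 0) s i j).
Proof. by move=> <-. Qed.

Lemma eq_det_rows s s' : size s = size s' ->
  (forall i j, (i < size s)%N -> (j < size s)%N ->
     nth (fun=> 0) s i j = nth (fun=> 0) s' i j) ->
  det_rows s = det_rows s'.
Proof.
move=> ss h; rewrite (det_rowsE (esym ss)); congr (\det _).
by apply/matrixP => i j; rewrite !mxE h.
Qed.

Lemma det_rows_cons (r : nat -> R) rs : det_rows (r :: rs) =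
  \sum_(j < (size rs).+1)
     (-1) ^+ j * det_rows [seq (fun i => g (bump j i)) | g <- rs] * r j.
Proof.
rewrite (@det_rowsE (size rs).+1) // (expand_det_row _ ord0).
apply: eq_bigr => j _; rewrite !mxE /= mulrC; congr (_ * _).
rewrite /cofactor add0n; congr (_ * _).
rewrite (@det_rowsE (size rs)) ?size_map //; congr (\det _).
by apply/matrixP => i k; rewrite !mxE /= (nth_map (fun=> 0)).
Qed.

Lemma det_rows_dup (r : nat -> R) rs i : (i < size rs)%N ->
  (forall j, nth (fun=> 0) rs i j = r j) -> det_rows (r :: rs) = 0.
Proof.
move=> ltis h; rewrite (@det_rowsE (size rs).+1) //.
apply: (@determinant_alternate _ _ _ ord0 (lift ord0 (Ordinal ltis))) => //.
by move=> j; rewrite !mxE /= h.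
Qed.

Lemma det_rows_scale (T : Type) (ls : seq T) (kappa : T -> R)
    (g : T -> nat -> R) :
  det_rows [seq (fun j => kappa l * g l j) | l <- ls] =
  \prod_(l <- ls) kappa l * det_rows [seq g l | l <- ls].
Proof.
case: ls => [|l0 ls0]; first by rewrite big_nil mul1r.
set ls := l0 :: ls0.
rewrite !(@det_rowsE (size ls)) ?size_map //.
have -> : \prod_(l <- ls) kappa l = \det (diag_mx (\row_(i < size ls) kappa (nth l0 ls i))).
  by rewrite det_diag (big_nth l0) big_mkord; apply: eq_bigr => i _; rewrite mxE.
rewrite -det_mulmx; congr (\det _).
by apply/matrixP => i j; rewrite mul_diag_mx !mxE !(nth_map l0).
Qed.

End DetRows.

Section Christoffel.
Variables (R : realType) (L : {poly R} -> R) (P : nat -> {poly R}).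
Hypothesis linL : functional L.
Hypothesis size_P : forall n, size (P n) = n.+1.
Hypothesis orth : forall n (r : {poly R}), (size r <= n)%N -> L (P n * r) = 0.

Definition christoffel_rows x (ls : seq R) : seq (nat -> R) :=
  [seq (fun j : nat => (P (x + j)).[l]) | l <- ls].

Definition christoffel_det x ls := det_rows (christoffel_rows x ls).

Variable ls : seq R.
Hypothesis uniq_ls : uniq ls.
Local Notation k := (size ls).
Local Notation D x := (christoffel_det x ls).

Definition christoffel_weight : {poly R} := \prod_(l <- ls) ('X - l%:P).

Let minor x j :=
  det_rows [seq (fun i => g (bump j i)) | g <- christoffel_rows x ls].

(** The determinant with first row P_x, P_{x+1}, ..., given by its expansion along that row because
    [det_rows] has real entries. *)
Definition christoffel_poly x : {poly R} :=
  \sum_(j < k.+1) ((-1) ^+ j * minor x j) *: P (x + j).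

Local Notation Q := christoffel_poly.

Lemma horner_christoffel_poly x s : (Q x).[s] = christoffel_det x (s :: ls).
Proof.
rewrite /christoffel_det /= det_rows_cons size_map horner_sum.
by apply: eq_bigr => j _; rewrite hornerZ.
Qed.

(** Deleting the last column keeps the starting index x, deleting the first one shifts it to x + 1.
    Hence the leading coefficient of [Q x] carries [D x] and its lowest term carries [D x.+1], the
    two factors in the denominator of the mass. *)
Let minor_last x : minor x k = D x.
Proof.
apply: eq_det_rows; rewrite !size_map // => i j lti ltj.
rewrite (nth_map (fun=> 0)) ?size_map // !(nth_map 0) //=.
by rewrite /bump leqNgt ltj.
Qed.

Let minor_first x : minor x 0 = D x.+1.
Proof.
apply: eq_det_rows; rewrite !size_map // => i j lti ltj.
by rewrite (nth_map (fun=> 0)) ?size_map // !(nth_map 0) //= addSnnS.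
Qed.

Lemma christoffel_root x l : l \in ls -> root (Q x) l.
Proof.
move=> lls; rewrite /root horner_christoffel_poly /christoffel_det /=.
rewrite (@det_rows_dup _ _ _ (index l ls)) ?eqxx ?size_map ?index_mem // => j.
by rewrite (nth_map 0) ?index_mem // nth_index.
Qed.

Lemma christoffel_weight_dvd x : christoffel_weight %| Q x.
Proof.
apply: uniq_roots_dvdp; last by rewrite uniq_rootsE.
by apply/allP => l lls; apply: christoffel_root.
Qed.

Definition christoffel_quo x : {poly R} := Q x %/ christoffel_weight.
Local Notation q := christoffel_quo.
Local Notation rho := christoffel_weight.

Lemma christoffel_polyE x : Q x = rho * q x.
Proof. by rewrite mulrC divpK // christoffel_weight_dvd. Qed.

Lemma horner_christoffel_weight s : rho.[s] = \prod_(l <- ls) (s - l).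
Proof. by rewrite horner_prod; under eq_bigr do rewrite hornerXsubC. Qed.

Lemma christoffel_poly_size x : (size (Q x) <= (x + k).+1)%N.
Proof.
apply: (leq_trans (size_sum _ _ _)); apply/bigmax_leqP => j _.
rewrite (leq_trans (size_scale_leq _ _)) // size_P ltnS leq_add2l -ltnS.
exact: ltn_ord.
Qed.

Lemma christoffel_poly_coef x :
  (Q x)`_(x + k) = (-1) ^+ k * D x * lead_coef (P (x + k)).
Proof.
rewrite coef_sum big_ord_recr big1 /= ?add0r => [|j _].
  by rewrite coefZ minor_last lead_coefE size_P.
rewrite coefZ nth_default ?mulr0 // size_P; have := ltn_ord j; lia.
Qed.

(** Every P_{x+j} with j > 0 is orthogonal to r; only the term j = 0 of the expansion survives. *)
Lemma christoffel_poly_orth x (r : {poly R}) : (size r <= x.+1)%N ->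
  L (Q x * r) = D x.+1 * L (P x * r).
Proof.
move=> sr; rewrite mulr_suml functional_sum // big_ord_recl /= big1 => [|j _].
  by rewrite addr0 -scalerAl functionalZ // mul1r minor_first addn0.
rewrite -scalerAl functionalZ // orth ?mulr0 // (leq_trans sr) //=.
by rewrite /bump; lia.
Qed.

Hypothesis D_neq0 : forall x, D x != 0.

Let size_rho : size rho = k.+1.
Proof. by rewrite size_prod_XsubC. Qed.

Let monic_rho : rho \is monic.
Proof. by apply: monic_prod => l _; apply: monicXsubC. Qed.

Let size_Q x : size (Q x) = (x + k).+1.
Proof.
apply/eqP; rewrite eqn_leq christoffel_poly_size /= ltnNge; apply/negP => sQ.
have /eqP := christoffel_poly_coef x; rewrite nth_default // eq_sym.
rewrite !mulf_eq0 signr_eq0 (negPf (D_neq0 _)).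
by rewrite (negPf (lead_coef_graded size_P _)).
Qed.

Lemma size_christoffel_quo x : size (q x) = x.+1.
Proof.
have := size_Q x; rewrite christoffel_polyE => sz.
have q0 : q x != 0 by apply/eqP => q0; move: sz; rewrite q0 mulr0 size_poly0.
move: sz; rewrite size_monicM // size_rho; lia.
Qed.

Lemma lead_christoffel_quo x :
  lead_coef (q x) = (-1) ^+ k * D x * lead_coef (P (x + k)).
Proof.
rewrite -christoffel_poly_coef.
have -> : (Q x)`_(x + k) = lead_coef (Q x) by rewrite lead_coefE size_Q.
by rewrite christoffel_polyE lead_coef_monicM.
Qed.

Lemma christoffel_quo_orth x (r : {poly R}) : (size r <= x)%N ->
  L (rho * (q x * r)) = 0.
Proof.
move=> sr; rewrite mulrA -christoffel_polyE christoffel_poly_orth ?orth ?mulr0 //.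
exact: leqW.
Qed.

(** One factor [rho * q x] is [Q x] and reduces to [D x.+1] times P_x; the other [q x] then counts
    only through its leading coefficient, which brings [D x]. *)
Lemma christoffel_quo_norm x : L (rho * (q x * q x)) =
  (-1) ^+ k * D x * D x.+1 * lead_coef (P (x + k)) / lead_coef (P x) *
  L (P x * P x).
Proof.
rewrite mulrA -christoffel_polyE christoffel_poly_orth ?size_christoffel_quo //.
rewrite (orth_coef linL size_P orth) ?size_christoffel_quo //.
have -> : (q x)`_x = lead_coef (q x) by rewrite lead_coefE size_christoffel_quo.
by rewrite lead_christoffel_quo; ring.
Qed.

End Christoffel.

(** * Factorials and binomials *)

Lemma sum_ord_trunc (V : nmodType) (f : nat -> V) m n : (m <= n)%N ->
  (forall i, (m <= i)%N -> f i = 0) -> \sum_(i < n) f i = \sum_(i < m) f i.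
Proof.
move=> lemn f0; rewrite (big_ord_widen _ f lemn) [RHS]big_mkcond /=.
by apply: eq_bigr => i _; case: ltnP => // /f0.
Qed.

Section Factorials.
Variable R : realType.
Implicit Types (a b c x y z : R) (i j n : nat).

Lemma natr_mul_bin_left n m :
  m.+1%:R * 'C(n, m.+1)%:R = (n%:R - m%:R) * 'C(n, m)%:R :> R.
Proof.
have [lemn|ltnm] := leqP m n; first by rewrite -natrB // -!natrM mul_bin_left.
by rewrite !bin_small ?mulr0 //; lia.
Qed.

Lemma natr_mul_bin_down n m :
  n%:R * 'C(n.-1, m)%:R = (n%:R - m%:R) * 'C(n, m)%:R :> R.
Proof.
have [lemn|ltnm] := leqP m n; first by rewrite -natrB // -!natrM mul_bin_down.
by rewrite !bin_small ?mulr0 //; lia.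
Qed.

Lemma pochhammer0 y : pochhammer y 0 = 1.
Proof. by rewrite /pochhammer big_ord0. Qed.

Lemma pochhammerS y j : pochhammer y j.+1 = pochhammer y j * (y + j%:R).
Proof. by rewrite /pochhammer big_ord_recr. Qed.

Lemma pochhammerD y i j :
  pochhammer y (i + j) = pochhammer y i * pochhammer (y + i%:R) j.
Proof.
elim: j => [|j IH]; first by rewrite addn0 pochhammer0 mulr1.
by rewrite addnS !pochhammerS IH natrD -!mulrA addrA.
Qed.

Lemma pochhammerSl y j : pochhammer y j.+1 = y * pochhammer (y + 1) j.
Proof. by rewrite -add1n pochhammerD pochhammerS pochhammer0 mul1r addr0. Qed.

Lemma pochhammer_neq0 c j : (forall n : nat, c != - n%:R) -> pochhammer c j != 0.
Proof.
by move=> hc; apply/prodf_neq0 => i _; rewrite addr_eq0.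
Qed.

Lemma pochhammer_gt0 c j : 0 < c -> 0 < pochhammer c j.
Proof.
by move=> c0; apply: prodr_gt0 => i _; rewrite ltr_wpDr.
Qed.

Lemma neq_oppnS c : (forall n : nat, c != - n%:R) ->
  forall n : nat, c + 1 != - n%:R.
Proof.
move=> hc n; apply: contra (hc n.+1) => /eqP h.
by rewrite mulrS opprD -h addrC addrK.
Qed.

Lemma gbinom0 x : gbinom x 0 = 1.
Proof. by rewrite /gbinom big_ord0 divr1. Qed.

Lemma gbinomS x j : gbinom x j.+1 = gbinom x j * (x - j%:R) / j.+1%:R.
Proof.
rewrite /gbinom big_ord_recr /= factS natrM invfM; ring.
Qed.

Lemma gbinomSl x j : gbinom (x + 1) j.+1 = gbinom x j * (x + 1) / j.+1%:R.
Proof.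
rewrite /gbinom big_ord_recl /= factS natrM invfM subr0.
under eq_bigr => i _ do rewrite /bump /= mulrS opprD addrA addrK.
by ring.
Qed.

Lemma gbinom_pascal x j : gbinom (x + 1) j.+1 = gbinom x j.+1 + gbinom x j.
Proof.
rewrite gbinomSl gbinomS; have : j.+1%:R != 0 :> R by [].
by rewrite mulrS => h; field; rewrite addrC.
Qed.

Lemma gbinom_nat (n j : nat) : gbinom n%:R j = 'C(n, j)%:R :> R.
Proof.
elim: j => [|j IH]; first by rewrite gbinom0 bin0.
have Sj : j.+1%:R != 0 :> R by [].
apply: (mulIf Sj); rewrite gbinomS IH divfK // mulrC.
by rewrite -natr_mul_bin_left mulrC.
Qed.

Lemma gbinom_opp y m : gbinom (- y) m = (-1) ^+ m * pochhammer y m / m`!%:R.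
Proof.
elim: m => [|m IH]; first by rewrite gbinom0 pochhammer0 divr1 mul1r.
by rewrite gbinomS IH pochhammerS factS natrM invfM exprS; ring.
Qed.

(** In the basis of falling factorials both the moments of L and the coefficients of the P_x have
    closed forms. *)
Definition ffact_poly j : {poly R} := \prod_(i < j) ('X - i%:R%:P).

Lemma ffact_polyS j : ffact_poly j.+1 = ffact_poly j * ('X - j%:R%:P).
Proof. by rewrite /ffact_poly big_ord_recr. Qed.

Lemma size_ffact_poly j : size (ffact_poly j) = j.+1.
Proof.
rewrite /ffact_poly -(big_mkord xpredT (fun i => 'X - i%:R%:P)).
by rewrite size_prod_XsubC size_iota subn0.
Qed.

Lemma monic_ffact_poly j : ffact_poly j \is monic.
Proof. by apply: monic_prod => i _; apply: monicXsubC. Qed.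

Lemma mulX_ffact_poly j :
  'X * ffact_poly j = ffact_poly j.+1 + j%:R *: ffact_poly j.
Proof. by rewrite ffact_polyS -mul_polyC; ring. Qed.

Lemma horner_ffact_polyS j s :
  (ffact_poly j.+1).[s] = (ffact_poly j).[s] * (s - j%:R).
Proof. by rewrite ffact_polyS hornerM hornerXsubC. Qed.

Lemma horner_ffact_poly_gbinom j s :
  (ffact_poly j).[s] = j`!%:R * gbinom s j.
Proof.
rewrite /gbinom mulrC divfK ?pnatr_eq0 -?lt0n ?fact_gt0 //.
by rewrite /ffact_poly horner_prod; apply: eq_bigr => i _; rewrite hornerXsubC.
Qed.

Lemma horner_ffact_poly_opp j y :
  (ffact_poly j).[- y] = (-1) ^+ j * pochhammer y j.
Proof.
by rewrite horner_ffact_poly_gbinom gbinom_opp mulrC divfK.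
Qed.

Lemma horner_ffact_poly_nat j n : (ffact_poly j).[n%:R] = (n ^_ j)%:R.
Proof.
by rewrite horner_ffact_poly_gbinom gbinom_nat mulrC -natrM bin_ffact.
Qed.

End Factorials.

(** * Meixner polynomials in the degree variable *)

Section DualMeixner.
Variables (R : realType) (a c : R).
Hypotheses (a_neq0 : a != 0) (a_neq1 : a != 1).
Hypothesis c_reg : forall n : nat, c != - n%:R.

Let onea : 1 - a != 0. Proof. by rewrite subr_eq0 eq_sym. Qed.
Let aone : a - 1 != 0. Proof. by rewrite subr_eq0. Qed.
Let poch0 j : pochhammer c j != 0. Proof. exact: pochhammer_neq0. Qed.
Let creg j : c + j%:R != 0. Proof. by rewrite addr_eq0. Qed.

Definition dual_meixner_coef (x i : nat) : R :=
  'C(x, i)%:R * ((a - 1) / a) ^+ i / pochhammer c i.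

(** The hypergeometric polynomial 2F1(-x, -s; c; 1 - 1/a) in s: the Meixner polynomial with degree
    and variable exchanged. *)
Definition dual_meixner (x : nat) : {poly R} :=
  \sum_(i < x.+1) dual_meixner_coef x i *: ffact_poly R i.

Local Notation P := dual_meixner.
Local Notation t := dual_meixner_coef.

Let t_eq0 x i : (x < i)%N -> t x i = 0.
Proof. by move=> h; rewrite /t bin_small // !mul0r. Qed.

Let P_widen x n : (x < n)%N -> P x = \sum_(i < n) t x i *: ffact_poly R i.
Proof.
move=> ltxn; symmetry; apply: (sum_ord_trunc (f := fun i => t x i *: ffact_poly R i)) => // i.
by move=> /t_eq0->; rewrite scale0r.
Qed.

Lemma dual_meixner0 : P 0 = 1.
Proof.
rewrite /dual_meixner big_ord1 /t /ffact_poly big_ord0.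
by rewrite pochhammer0 bin0 mul1r divr1 scale1r.
Qed.

Lemma dual_meixner_coefnn x : t x x = ((a - 1) / a) ^+ x / pochhammer c x.
Proof. by rewrite /t binn mul1r. Qed.

Let tnn_neq0 x : t x x != 0.
Proof.
by rewrite dual_meixner_coefnn mulf_neq0 ?invr_eq0 // expf_neq0 // mulf_neq0 ?invr_eq0.
Qed.

Lemma size_dual_meixner x : size (P x) = x.+1.
Proof.
rewrite /P big_ord_recr /= addrC size_polyDl.
  by rewrite size_scale // size_ffact_poly.
rewrite size_scale // size_ffact_poly ltnS.
apply: (leq_trans (size_sum _ _ _)); apply/bigmax_leqP => j _.
by rewrite (leq_trans (size_scale_leq _ _)) // size_ffact_poly.
Qed.

Lemma lead_dual_meixner x : lead_coef (P x) = ((a - 1) / a) ^+ x / pochhammer c x.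
Proof.
rewrite /P big_ord_recr /= addrC lead_coefDl.
  by rewrite lead_coefZ (monicP (monic_ffact_poly _ _)) mulr1 dual_meixner_coefnn.
rewrite size_scale // size_ffact_poly ltnS.
apply: (leq_trans (size_sum _ _ _)); apply/bigmax_leqP => j _.
by rewrite (leq_trans (size_scale_leq _ _)) // size_ffact_poly.
Qed.

(** The recurrence, regrouped as the difference equation a(x + c)(P_{x+1} - P_x) + x(P_{x-1} - P_x)
    = (a - 1) s P_x in x and read off at the i-th falling factorial. In this form Pascal's rule
    absorbs the first difference. *)
Let coef_rec x i : a * (x%:R + c) * (t x.+1 i - t x i) + x%:R * (t x.-1 i - t x i)
  = (a - 1) * ((if i is j.+1 then t x j else 0) + i%:R * t x i).
Proof.
case: i => [|i].
  by rewrite /t !bin0 !mul0r !subrr !mulr0 !addr0 mulr0.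
have t1 : t x.+1 i.+1 - t x i.+1 = 'C(x, i)%:R * ((a - 1) / a) ^+ i.+1 / pochhammer c i.+1.
  by rewrite /t binS natrD; ring.
have t2 : x%:R * t x.-1 i.+1 = (x%:R - i.+1%:R) * t x i.+1.
  by rewrite /t !mulrA natr_mul_bin_down.
have t3 : i.+1%:R * t x i.+1 =
    (x%:R - i%:R) * ('C(x, i)%:R * ((a - 1) / a) ^+ i.+1 / pochhammer c i.+1).
  by rewrite /t !mulrA natr_mul_bin_left.
have t4 : (a - 1) * t x i =
    a * (c + i%:R) * ('C(x, i)%:R * ((a - 1) / a) ^+ i.+1 / pochhammer c i.+1).
  rewrite /t pochhammerS exprS; move: (_ ^+ i) (creg i) (poch0 i) => w.
  by move=> ci p0; field; rewrite p0 ci a_neq0.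
rewrite t1 [x%:R * (_ - _)]mulrBr t2 [in RHS]mulrDr t4.
rewrite (_ : (x%:R - i.+1%:R) * t x i.+1 - x%:R * t x i.+1 = - (i.+1%:R * t x i.+1));
  last by ring.
by rewrite t3; ring.
Qed.

Lemma dual_meixner_rec x : 'X * P x =
  (a * (x%:R + c) / (a - 1)) *: P x.+1 +
  (- (x%:R + a * (x%:R + c)) / (a - 1)) *: P x + (x%:R / (a - 1)) *: P x.-1.
Proof.
rewrite (@P_widen x.+1 x.+2) // (@P_widen x.-1 x.+2) ?ltnS; last by lia.
have -> : 'X * P x = \sum_(i < x.+2)
    ((if i : nat is j.+1 then t x j else 0) + i%:R * t x i) *: ffact_poly R i.
  under [RHS]eq_bigr => i _ do rewrite scalerDl.
  rewrite big_split /= big_ord_recl /= scale0r add0r.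
  rewrite [X in _ + X](sum_ord_trunc (m := x.+1)
    (f := fun i => (i%:R * t x i) *: ffact_poly R i)) // => [|i /t_eq0->]; last first.
    by rewrite mulr0 scale0r.
  rewrite -big_split /= /P mulr_sumr; apply: eq_bigr => i _.
  by rewrite -scalerAr mulX_ffact_poly scalerDr scalerA [i%:R * _]mulrC.
rewrite (@P_widen x x.+2) // !scaler_sumr -!big_split /=; apply: eq_bigr => i _.
rewrite !scalerA -!scalerDl; congr (_ *: _).
apply: (mulfI aone); rewrite -coef_rec; field.
exact: aone.
Qed.

(** These are the factorial moments of the negative binomial law with weights proportional to a^s
    (c)_s / s!. *)
Lemma exists_dual_meixner_functional :
  exists2 L : {poly R} -> R, functional L &
    forall j, L (ffact_poly R j) = a ^+ j * pochhammer c j / (1 - a) ^+ j.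
Proof.
exact: (exists_functional_on_basis
  (fun j => a ^+ j * pochhammer c j / (1 - a) ^+ j) (@size_ffact_poly R)).
Qed.

Section Functional.
Variable L : {poly R} -> R.
Hypothesis linL : functional L.
Hypothesis Lffact : forall j,
  L (ffact_poly R j) = a ^+ j * pochhammer c j / (1 - a) ^+ j.

(** The moments cancel the coefficients of P_{n+1} up to signed binomials, whose sum is (1 -
    1)^(n+1). *)
Lemma dual_meixner_functionalS n : L (P n.+1) = 0.
Proof.
rewrite /P functional_sum //.
transitivity (\sum_(i < n.+2) 'C(n.+1, i)%:R * (-1) ^+ i : R).
  apply: eq_bigr => i _; rewrite functionalZ // Lffact /t.
  have -> : (a - 1) / a = -1 * ((1 - a) / a) by rewrite mulrA mulN1r opprB.
  rewrite exprMn expr_div_n; move: ((-1) ^+ i) (poch0 i) => e.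
  have : a ^+ i != 0 by rewrite expf_neq0.
  have : (1 - a) ^+ i != 0 by rewrite expf_neq0.
  move: (a ^+ i) ((1 - a) ^+ i) => u v h1 h2 h3; field.
  by rewrite h1 h2 h3.
have := exprDn 1 (-1 : R) n.+1; rewrite subrr expr0n /= => /esym h; rewrite -[RHS]h.
by apply: eq_bigr => i _; rewrite expr1n mul1r mulr_natl.
Qed.

Let alpha n := a * (n%:R + c) / (a - 1).
Let beta n := - (n%:R + a * (n%:R + c)) / (a - 1).
Let gamma n : R := n%:R / (a - 1).

Lemma dual_meixner_orth n (r : {poly R}) : (size r <= n)%N -> L (P n * r) = 0.
Proof.
exact: (@favard_orth _ _ _ linL alpha beta gamma dual_meixner_rec
  dual_meixner_functionalS).
Qed.

Lemma dual_meixner_norm n :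
  L (P n * P n) = n`!%:R / (a ^+ n * pochhammer c n).
Proof.
elim: n => [|n IH].
  rewrite dual_meixner0 mulr1 expr0 pochhammer0 mul1r divr1.
  have := Lffact 0; rewrite /ffact_poly big_ord0 !expr0 pochhammer0.
  by rewrite mul1r divr1.
have := @favard_norm _ _ _ linL size_dual_meixner alpha beta gamma
  dual_meixner_rec dual_meixner_functionalS n.
rewrite /gamma /alpha IH => h.
have cn : n%:R + c != 0 by rewrite addrC.
have k0 : a * (n%:R + c) / (a - 1) != 0 by rewrite !mulf_neq0 ?invr_eq0.
apply: (mulfI k0); rewrite h factS natrM pochhammerS exprS.
have := poch0 n; have : a ^+ n != 0 by rewrite expf_neq0.
by move: (a ^+ n) => u h1 h2; field; rewrite h1 h2 a_neq0 aone creg.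
Qed.

End Functional.
End DualMeixner.

(** * Exchange of degree and variable; the Pfaff transformation *)

Section Duality.
Variable R : realType.
Implicit Types (a c x y z al : R).

Let bin_sum al (n : nat) x y : R :=
  \sum_(j < n.+1) al ^+ j * gbinom x j * gbinom y (n - j).

Let bin_sumS al n x y :
  bin_sum al n.+1 (x + 1) y = bin_sum al n.+1 x y + al * bin_sum al n x y.
Proof.
rewrite /bin_sum [LHS]big_ord_recl [X in _ = X + _]big_ord_recl /= !gbinom0 -addrA.
congr (_ + _).
rewrite mulr_sumr -big_split /=; apply: eq_bigr => j _.
by rewrite /bump /= add1n subSS gbinom_pascal exprS; ring.
Qed.

Let dual_sum (u : R) (n x : nat) c : R :=
  \sum_(i < n.+1) 'C(x, i)%:R * u ^+ i * gbinom (- (c + i%:R)) (n - i).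

Let dual_sumS u n (x : nat) c : dual_sum u n.+1 x.+1 c =
  dual_sum u n.+1 x (c + 1) + (1 + u) * dual_sum u n x (c + 1).
Proof.
have h1 : dual_sum u n.+1 x.+1 c = dual_sum u n.+1 x c + u * dual_sum u n x (c + 1).
  rewrite /dual_sum [LHS]big_ord_recl [X in _ = X + _]big_ord_recl /= !bin0 -addrA.
  congr (_ + _).
  rewrite mulr_sumr -big_split /=; apply: eq_bigr => j _.
  rewrite /bump /= add1n subSS binS natrD exprS [j.+1%:R]mulrS addrA; ring.
have h2 : dual_sum u n.+1 x c = dual_sum u n.+1 x (c + 1) + dual_sum u n x (c + 1).
  rewrite /dual_sum [LHS]big_ord_recr [X in X + _ = _]/=.
  rewrite [X in _ = X + _]big_ord_recr /= subnn !gbinom0 addrAC.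
  congr (_ + _); rewrite -big_split /=; apply: eq_bigr => j _.
  rewrite subSn; last by rewrite -ltnS.
  have -> : - (c + j%:R) = - (c + 1 + j%:R) + 1 by ring.
  by rewrite gbinom_pascal; ring.
by rewrite h1 h2; ring.
Qed.

(** Passing from (x + 1, c) to (x, c + 1) leaves -x - c unchanged, and both sides then obey the same
    Pascal-type recursion, with [1 + u = al] for [u = al - 1]. *)
Let bin_sumE al n (x : nat) c :
  bin_sum al n x%:R (- x%:R - c) = dual_sum (al - 1) n x c.
Proof.
elim: x n c => [|x IH] n c.
  rewrite /bin_sum /dual_sum !big_ord_recl /= !big1.
  - by rewrite bin0 gbinom0 !addr0 oppr0 add0r !expr0 mulr1.
  - by move=> i _; rewrite bin0n !mul0r.
  - by move=> i _; rewrite [gbinom 0 _](gbinom_nat R 0) bin0n mulr0 mul0r.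
have -> : - x.+1%:R - c = - x%:R - (c + 1) by rewrite mulrS; ring.
case: n => [|n]; first by rewrite /bin_sum /dual_sum !big_ord_recl !big_ord0 /= !bin0 !gbinom0.
by rewrite dual_sumS -{1}natr1 bin_sumS !IH [1 + _]addrC subrK.
Qed.

Lemma meixner_dual a c (n x : nat) :
  a != 0 -> a != 1 -> (forall m : nat, c != - m%:R) ->
  meixner a c n x%:R =
    (a / (a - 1)) ^+ n * pochhammer c n / n`!%:R * (dual_meixner a c x).[n%:R].
Proof.
move=> a0 a1 hc.
have a10 : a - 1 != 0 by rewrite subr_eq0.
transitivity (a ^+ n / (1 - a) ^+ n * bin_sum a^-1 n x%:R (- x%:R - c)).
  by congr (_ * _); apply: eq_bigr => j _; rewrite exprVn.
rewrite bin_sumE /dual_sum /dual_meixner horner_sum.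
under [in RHS]eq_bigr do rewrite hornerZ horner_ffact_poly_nat.
(* The summand vanishes for i > x through the binomial and for i > n through the falling factorial,
   so the range can be changed from x to n by way of x + n. *)
rewrite -(@sum_ord_trunc _ (fun i => dual_meixner_coef a c x i * (n ^_ i)%:R) x.+1
  (x + n).+1) ?ltnS ?leq_addr //; last first.
  by move=> i h; rewrite /dual_meixner_coef bin_small // !mul0r.
rewrite (@sum_ord_trunc _ (fun i => dual_meixner_coef a c x i * (n ^_ i)%:R) n.+1
  (x + n).+1) ?ltnS ?leq_addl //; last first.
  by move=> i h; rewrite ffact_small // mulr0.
rewrite !mulr_sumr; apply: eq_bigr => -[i] /=; rewrite ltnS => lein _.
rewrite gbinom_opp /dual_meixner_coef.
have -> : (n ^_ i)%:R = n`!%:R / (n - i)`!%:R :> R.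
  have f0 : (n - i)`!%:R != 0 :> R by rewrite pnatr_eq0 -lt0n fact_gt0.
  by apply: (mulIf f0); rewrite divfK // -natrM ffact_fact.
have [m ->] : exists m, n = (m + i)%N by exists (n - i)%N; rewrite subnK.
rewrite addnK [pochhammer c _](_ : _ = pochhammer c i * pochhammer (c + i%:R) m);
  last by rewrite addnC pochhammerD.
have -> : a^-1 - 1 = - ((a - 1) / a) by field.
have -> : a / (a - 1) = - (a / (1 - a)) by rewrite -[1 - a]opprB invrN mulrN opprK.
rewrite -expr_div_n (exprNn ((a - 1) / a)) (exprNn (a / (1 - a))) !exprD.
have p0 : pochhammer c i != 0 by exact: pochhammer_neq0.
have f0 : (m + i)`!%:R != 0 :> R by rewrite pnatr_eq0 -lt0n fact_gt0.
have f1 : m`!%:R != 0 :> R by rewrite pnatr_eq0 -lt0n fact_gt0.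
move: ((-1) ^+ i) => e; move: ((-1) ^+ m) => em.
move: (((a - 1) / a) ^+ i) ((a / (1 - a)) ^+ i) ((a / (1 - a)) ^+ m) => A B C.
by field; rewrite f0 f1 p0.
Qed.

(** The terminating series 2F1(-x, b; c; -z). *)
Let hyp_sum (z : R) (x : nat) (b c : R) : R :=
  \sum_(i < x.+1) 'C(x, i)%:R * z ^+ i * pochhammer b i / pochhammer c i.

Let hyp_sumS z (x : nat) b c : c != 0 -> hyp_sum z x.+1 b c =
  hyp_sum z x b c + z * b / c * hyp_sum z x (b + 1) (c + 1).
Proof.
move=> c0.
have -> : hyp_sum z x b c =
  \sum_(i < x.+2) 'C(x, i)%:R * z ^+ i * pochhammer b i / pochhammer c i.
  by rewrite /hyp_sum [RHS]big_ord_recr /= (bin_small (ltnSn x)) !mul0r addr0.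
rewrite /hyp_sum [LHS]big_ord_recl [X in _ = X + _]big_ord_recl /= !bin0 -addrA.
congr (_ + _).
rewrite mulr_sumr -big_split /=; apply: eq_bigr => j _.
by rewrite /bump /= add1n binS natrD exprS !pochhammerSl invfM; ring.
Qed.

(** Term by term this is (c - b) + (b + j) = c + j. It eliminates the parameters (b + 1, c + 1),
    which the induction for the Pfaff transformation cannot reach. *)
Let hyp_sum_contig z (x : nat) b c : (forall n : nat, c != - n%:R) -> hyp_sum z x b c =
  (c - b) / c * hyp_sum z x b (c + 1) + b / c * hyp_sum z x (b + 1) (c + 1).
Proof.
move=> hc; have c0 : c != 0 by have := hc 0%N; rewrite oppr0.
rewrite /hyp_sum !mulr_sumr -big_split /=; apply: eq_bigr => j _.
have p1 : pochhammer (c + 1) j != 0 by apply/pochhammer_neq0/neq_oppnS.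
have p0 : pochhammer c j != 0 by exact: pochhammer_neq0.
have : c * pochhammer (c + 1) j = pochhammer c j * (c + j%:R).
  by rewrite -pochhammerSl pochhammerS.
have : b * pochhammer (b + 1) j = pochhammer b j * (b + j%:R).
  by rewrite -pochhammerSl pochhammerS.
move: (pochhammer (c + 1) j) (pochhammer c j) p1 p0 => C1 C0 p1 p0.
move: (pochhammer (b + 1) j) (pochhammer b j) => B1 B0 hB hC.
have cj : c + j%:R != 0 by rewrite addr_eq0.
have -> : C1 = C0 * (c + j%:R) / c by rewrite -hC mulrC mulrA mulVf // mul1r.
have -> : 'C(x, j)%:R * z ^+ j * B1 / (C0 * (c + j%:R) / c) =
  'C(x, j)%:R * z ^+ j * B1 * c / (C0 * (c + j%:R)) by rewrite invf_div mulrA.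
have -> : b / c * ('C(x, j)%:R * z ^+ j * B1 * c / (C0 * (c + j%:R))) =
  'C(x, j)%:R * z ^+ j * (b * B1) / (C0 * (c + j%:R)) by field; rewrite p0 cj c0.
by rewrite hB; move: (z ^+ j) => w; field; rewrite p0 cj c0.
Qed.

Let pfaff a (x : nat) b c : a != 0 -> (forall n : nat, c != - n%:R) ->
  hyp_sum (a - 1) x b c = a ^+ x * hyp_sum ((1 - a) / a) x (c - b) c.
Proof.
move=> a0; elim: x b c => [|x IH] b c hc.
  by rewrite /hyp_sum !big_ord_recl !big_ord0 !bin0 !pochhammer0 !expr0 mul1r.
have c0 : c != 0 by have := hc 0%N; rewrite oppr0.
rewrite !hyp_sumS // exprS.
transitivity (a * (a ^+ x * hyp_sum ((1 - a) / a) x (c - b) c) +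
  (1 - a) * (c - b) / c * (a ^+ x * hyp_sum ((1 - a) / a) x (c - b + 1) (c + 1)));
  last by field; rewrite c0 a0.
rewrite -IH // -addrA [- b + 1]addrC addrA -IH; last exact: neq_oppnS.
by rewrite [hyp_sum _ _ b c]hyp_sum_contig //; field.
Qed.

Let horner_dual_meixner_opp a c (x : nat) y :
  (dual_meixner a c x).[- y] = hyp_sum ((1 - a) / a) x y c.
Proof.
rewrite /dual_meixner horner_sum; apply: eq_bigr => i _.
rewrite hornerZ horner_ffact_poly_opp /dual_meixner_coef.
rewrite -[a - 1]opprB mulNr (exprNn ((1 - a) / a)); move: (((1 - a) / a) ^+ i) => w.
have : (-1) ^+ i * (-1) ^+ i = 1 :> R by rewrite -exprMn mulrNN mulr1 expr1n.
move: ((-1) ^+ i) => e ee; rewrite -[RHS]mul1r -[X in _ = X * _]ee; ring.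
Qed.

(** With b = -y the parameter c - b of the Pfaff transformation is c + y, which corresponds to
    evaluation at -c - y. Rows with parameter 1/a thereby become rows of the same P_x at reflected
    nodes. *)
Lemma dual_meixner_pfaff a c (x : nat) y : a != 0 -> (forall n : nat, c != - n%:R) ->
  (dual_meixner a^-1 c x).[y] = a ^+ x * (dual_meixner a c x).[- c - y].
Proof.
move=> a0 hc; rewrite -{1}[y]opprK -opprD !horner_dual_meixner_opp.
have -> : (1 - a^-1) / a^-1 = a - 1 by field.
by rewrite pfaff // opprK.
Qed.

Lemma meixner_inv_dual a c (n x : nat) :
  a != 0 -> a != 1 -> (forall m : nat, c != - m%:R) ->
  meixner a^-1 c n x%:R = (1 - a) ^- n * pochhammer c n / n`!%:R *
    (a ^+ x * (dual_meixner a c x).[- c - n%:R]).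
Proof.
move=> a0 a1 hc; rewrite meixner_dual ?invr_eq0 // ?invr_eq1 //.
have a10 : 1 - a != 0 by rewrite subr_eq0 eq_sym.
have -> : a^-1 / (a^-1 - 1) = (1 - a)^-1 by field; rewrite a0 a10.
by rewrite exprVn dual_meixner_pfaff.
Qed.

End Duality.

(** * Exceptional Meixner polynomials *)

Section ExceptionalAlgebra.
Variables (R : realType) (a c : R) (F1 F2 : {fset nat}).
Hypotheses (a_neq0 : a != 0) (a_neq1 : a != 1).
Hypothesis c_reg : forall n : nat, c != - n%:R.
Hypothesis Omega_neq0 : forall n : nat, OmegaF a c F1 F2 n%:R != 0.

Local Notation P := (dual_meixner a c).
Local Notation Omega x := (OmegaF a c F1 F2 x).
Local Notation k := (nF F1 F2).
Local Notation k2 := (#|` F2|).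

(* A row of the matrices is labelled by (b, f), where b tells F1 from F2. *)
Definition row_labels : seq (bool * nat) :=
  [seq (true, f) | f <- sort leq (enum_fset F1)] ++
  [seq (false, f) | f <- sort leq (enum_fset F2)].

Definition row_node (l : bool * nat) : R :=
  if l.1 then l.2%:R else - c - l.2%:R.

Definition row_nodes := [seq row_node l | l <- row_labels].

Let row_const (l : bool * nat) : R :=
  (if l.1 then (a / (a - 1)) ^+ l.2 else (1 - a) ^- l.2) *
  pochhammer c l.2 / l.2`!%:R.

(** The division by a^j in the rows of F2 reduces the a^(x+j) of duality to a^x, which no longer
    depends on the column and leaves the determinant. *)
Let row_scale (x : nat) (l : bool * nat) : R :=
  row_const l * (if l.1 then 1 else a ^+ x).

Let onea : 1 - a != 0. Proof. by rewrite subr_eq0 eq_sym. Qed.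
Let aone : a - 1 != 0. Proof. by rewrite subr_eq0. Qed.

Let row_const_neq0 l : row_const l != 0.
Proof.
rewrite /row_const !mulf_neq0 ?pochhammer_neq0 //.
by case: ifP => _; rewrite ?invr_eq0 expf_neq0 // mulf_neq0 ?invr_eq0.
Qed.

Let F_rowsE (x : nat) : F_rows a c F1 F2 x%:R =
  [seq (fun j => row_scale x l * (P (x + j)).[row_node l]) | l <- row_labels].
Proof.
rewrite /F_rows map_cat -!map_comp; congr (_ ++ _).
  apply: eq_map => f /=; apply/funext => j.
  by rewrite /row_scale /row_const /= mulr1 -natrD meixner_dual.
apply: eq_map => f /=; apply/funext => j; rewrite -natrD meixner_inv_dual //.
have : a ^+ j != 0 by rewrite expf_neq0.
have : f`!%:R != 0 :> R by rewrite pnatr_eq0 -lt0n fact_gt0.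
rewrite /row_scale /row_const /= exprD.
by move: (_ ^- _) (a ^+ x) (a ^+ j) => u v w f0 aj; field; rewrite aj f0.
Qed.

Lemma size_row_nodes : size row_nodes = k.
Proof. by rewrite size_map size_cat !size_map !size_sort. Qed.

Let prod_row_const := \prod_(l <- row_labels) row_const l.

Let prod_row_const_neq0 : prod_row_const != 0.
Proof. by rewrite prodf_seq_neq0; apply/allP => l _; rewrite row_const_neq0. Qed.

Let prod_row_scale x :
  \prod_(l <- row_labels) row_scale x l = prod_row_const * a ^+ (x * k2).
Proof.
rewrite /prod_row_const big_split /=; congr (_ * _).
rewrite big_cat /= !big_map /= big1 // mul1r.
by rewrite big_const_seq count_predT size_sort iter_mulr_1 exprM.
Qed.

Let OmegaE (x : nat) : Omega x%:R =
  prod_row_const * a ^+ (x * k2) * christoffel_det P x row_nodes.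
Proof.
rewrite /OmegaF F_rowsE det_rows_scale prod_row_scale; congr (_ * _).
by rewrite /christoffel_det /christoffel_rows /row_nodes -map_comp.
Qed.

Lemma meixnerF_christoffel : forall n, exists2 b, b != 0 &
  forall x : nat, meixnerF a c F1 F2 n x%:R =
    b * a ^+ (x * k2) * (christoffel_poly P row_nodes x).[(n - uF F1 F2)%:R].
Proof.
move=> n; set s := (n - uF F1 F2)%N.
exists (row_const (true, s) * prod_row_const); first exact: mulf_neq0.
move=> x; rewrite /meixnerF F_rowsE -/s.
(* The top row has the form of an F1 row of degree s, so it is treated as one more label. *)
have -> : (fun j : nat => meixner a c s (x%:R + j%:R)) =
    (fun j => row_scale x (true, s) * (P (x + j)).[row_node (true, s)]).
  by apply/funext => j; rewrite /row_scale /row_const /= mulr1 -natrD meixner_dual.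
rewrite -(map_cons (fun l (j : nat) => row_scale x l * (P (x + j)).[row_node l])).
rewrite det_rows_scale big_cons prod_row_scale horner_christoffel_poly.
rewrite {1}/row_scale mulr1 mulrA; congr (_ * _).
by rewrite /christoffel_det /christoffel_rows /row_nodes /= -map_comp.
Qed.

Let D_neq0 x : christoffel_det P x row_nodes != 0.
Proof.
have := Omega_neq0 x; rewrite OmegaE; apply: contraNN => /eqP->.
by rewrite mulr0.
Qed.

(** A coincidence m = -c - n between the two families would make c equal to -(m + n). Distinct nodes
    are what allows division by [rho]. *)
Lemma uniq_row_nodes : uniq row_nodes.
Proof.
rewrite map_inj_in_uniq; last first.
  move=> [b f] [b' f']; rewrite !mem_cat => _ _; rewrite /row_node /=.
  have cross (m n : nat) : m%:R = - c - n%:R :> R -> False.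
    move=> h; have /eqP := c_reg (m + n); apply.
    by rewrite natrD h; ring.
  case: b; case: b' => /=.
  - by move=> /eqP; rewrite eqr_nat => /eqP->.
  - by move/cross.
  - by move/esym/cross.
  - by move=> /addrI/oppr_inj/eqP; rewrite eqr_nat => /eqP->.
rewrite cat_uniq !map_inj_uniq ?sort_uniq ?fset_uniq //=; try by move=> ? ? [].
by rewrite andbT; apply/hasPn => -[b f] /mapP[? _ [-> _]]; apply/negP => /mapP[].
Qed.

Section Functional.
Variable L : {poly R} -> R.
Hypothesis linL : functional L.
Hypothesis Lffact : forall j,
  L (ffact_poly R j) = a ^+ j * pochhammer c j / (1 - a) ^+ j.
Hypothesis GammaD : forall n, Gamma (c + n%:R) = Gamma c * pochhammer c n.

Local Notation rho := (christoffel_weight row_nodes).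
Local Notation q := (christoffel_quo P row_nodes).
Local Notation D x := (christoffel_det P x row_nodes).
Local Notation Q := (christoffel_poly P row_nodes).

Let size_P := size_dual_meixner a_neq0 a_neq1 c_reg.
Let orthP := dual_meixner_orth a_neq0 a_neq1 c_reg linL Lffact.
Let poch0 j : pochhammer c j != 0. Proof. exact: pochhammer_neq0. Qed.
Let fact0 n : n`!%:R != 0 :> R. Proof. by rewrite pnatr_eq0 -lt0n fact_gt0. Qed.

Lemma size_exceptional_quo x : size (q x) = x.+1.
Proof. exact: (size_christoffel_quo size_P uniq_row_nodes D_neq0). Qed.

Lemma exceptional_quo_orth x (r : {poly R}) : (size r <= x)%N ->
  L (rho * (q x * r)) = 0.
Proof. exact: (christoffel_quo_orth linL orthP uniq_row_nodes). Qed.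

Lemma exceptional_quo_norm x : L (rho * (q x * q x)) =
  ((1 - a) / a) ^+ k * D x * D x.+1 * x`!%:R / (a ^+ x * pochhammer c (x + k)).
Proof.
rewrite (christoffel_quo_norm linL size_P orthP uniq_row_nodes D_neq0).
rewrite (dual_meixner_norm a_neq0 a_neq1 c_reg linL Lffact) size_row_nodes.
rewrite !(lead_dual_meixner a_neq0 a_neq1 c_reg) exprD.
have -> : (1 - a) / a = -1 * ((a - 1) / a) by rewrite mulrA mulN1r opprB.
rewrite [(-1 * _) ^+ k]exprMn; have : ((a - 1) / a) ^+ x != 0.
  by rewrite expf_neq0 // mulf_neq0 ?invr_eq0.
have : a ^+ x != 0 by rewrite expf_neq0.
move: (((a - 1) / a) ^+ x) (((a - 1) / a) ^+ k) ((-1) ^+ k) (a ^+ x) (poch0 x).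
by move=> A B E C h1 h2 h3; field; rewrite h1 h2 h3 poch0.
Qed.

Lemma exceptional_quo_norm_neq0 x : L (rho * (q x * q x)) != 0.
Proof.
rewrite exceptional_quo_norm !mulf_neq0 ?D_neq0 ?fact0 ?invr_eq0 //.
  by rewrite expf_neq0 // mulf_neq0 ?invr_eq0.
by rewrite mulf_neq0 ?expf_neq0.
Qed.

(** The product Omega(x) Omega(x + 1) and the norm of q_x share the factor [D x * D x.+1], so the
    mass is a reciprocal norm. The squared power of a is what two exceptional polynomials bring in,
    so it disappears from the integrand. *)
Let massE x : massF a c F1 F2 x = Gamma c * ((1 - a) / a) ^+ k /
  (prod_row_const ^+ 2 * a ^+ k2) / (a ^+ (x * k2)) ^+ 2 / L (rho * (q x * q x)).
Proof.
rewrite /massF exceptional_quo_norm.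
rewrite natr1 !OmegaE mulSn exprD.
have -> : x%:R + c + k%:R = c + (x + k)%:R by rewrite natrD; ring.
rewrite GammaD.
have h1 := D_neq0 x; have h2 := D_neq0 x.+1; have h3 := prod_row_const_neq0.
have h4 : ((1 - a) / a) ^+ k != 0 by rewrite expf_neq0 // mulf_neq0 ?invr_eq0.
have h5 : a ^+ x != 0 by rewrite expf_neq0.
have h6 : a ^+ k2 != 0 by rewrite expf_neq0.
have h7 : a ^+ (x * k2) != 0 by rewrite expf_neq0.
move: (((1 - a) / a) ^+ k) (a ^+ x) (a ^+ k2) (a ^+ (x * k2)) h4 h5 h6 h7.
move=> A B C E h4 h5 h6 h7; field.
by rewrite h1 h2 h3 h4 h5 h6 h7 poch0 fact0.
Qed.

Lemma massF_ge0 x : 0 < a < 1 ->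
  (0 <= massF a c F1 F2 x) = (0 <= Gamma c * L (rho * (q x * q x))).
Proof.
move=> /andP[a0 a1]; rewrite massE.
have p1 : 0 < ((1 - a) / a) ^+ k by rewrite exprn_gt0 // divr_gt0 // subr_gt0.
have p2 : 0 < prod_row_const ^+ 2 * a ^+ k2.
  apply: mulr_gt0; last exact: exprn_gt0.
  by rewrite lt0r sqr_ge0 sqrf_eq0 prod_row_const_neq0.
have p3 : 0 < (a ^+ (x * k2)) ^+ 2 by rewrite !exprn_gt0.
have N0 := exceptional_quo_norm_neq0 x; move: (L _) N0 => N N0.
have p4 : 0 < N ^+ 2 by rewrite lt0r sqr_ge0 sqrf_eq0 N0.
(* The norm stands in the denominator on the left and in the numerator on the right; dividing by its
   square reconciles the two signs. *)
rewrite -[RHS](pmulr_lge0 (x := ((1 - a) / a) ^+ k / (prod_row_const ^+ 2 * a ^+ k2) / (a ^+ (x * k2)) ^+ 2 / N ^+ 2)).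
  congr (0 <= _); rewrite expr2; field.
  by rewrite N0 prod_row_const_neq0 !expf_neq0 ?lt0r_neq0.
by rewrite !divr_gt0.
Qed.

(* Christoffel-Darboux in the dual variable. *)
Lemma massF_partial_sum n r : (uF F1 F2 <= n)%N -> (uF F1 F2 <= r)%N -> n <> r ->
  exists K, forall N : nat,
    \sum_(x < N.+1) massF a c F1 F2 x *
      (meixnerF a c F1 F2 n x%:R * meixnerF a c F1 F2 r x%:R) =
    K * (a ^+ N * pochhammer c (N.+1 + k) / N`!%:R / Omega N.+1%:R ^+ 2 *
      (meixnerF a c F1 F2 n N.+1%:R * meixnerF a c F1 F2 r N%:R -
       meixnerF a c F1 F2 n N%:R * meixnerF a c F1 F2 r N.+1%:R)).
Proof.
move=> len ler nr.
have [bn bn0 hn] := meixnerF_christoffel n.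
have [br br0 hr] := meixnerF_christoffel r.
set s := (n - uF F1 F2)%:R : R in hn; set t := (r - uF F1 F2)%:R : R in hr.
have st : s - t != 0.
  by rewrite subr_eq0 /s /t eqr_nat; apply/eqP; lia.
set kap := Gamma c * ((1 - a) / a) ^+ k / (prod_row_const ^+ 2 * a ^+ k2) * bn * br.
pose M x := L (rho * (q x * q x)).
have M0 x : M x != 0 by exact: exceptional_quo_norm_neq0.
have ax0 m : a ^+ m != 0 by rewrite expf_neq0.
have C0 := prod_row_const_neq0.
(* The factor [a / (a - 1)] comes from the ratio of leading coefficients, the power of [(1 - a) / a]
   from the norm, and the rest from returning to Omega and the exceptional polynomials. [D N]
   cancels between that ratio and the norm, which leaves the square of Omega at N + 1. *)
exists (kap / (s - t) * (a / (a - 1)) / ((1 - a) / a) ^+ k *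
  (prod_row_const ^+ 2 * a ^+ k2 / (bn * br))) => N.
have term x : massF a c F1 F2 x *
      (meixnerF a c F1 F2 n x%:R * meixnerF a c F1 F2 r x%:R) =
    kap * (rho.[s] * rho.[t]) * ((q x).[s] * (q x).[t] / M x).
  rewrite massE hn hr !(christoffel_polyE _ uniq_row_nodes) !hornerM -/(M x) /kap.
  have := M0 x; move: (M x) (ax0 (x * k2)%N) (ax0 k2) => y.
  move: (a ^+ (x * k2)) (a ^+ k2) (((1 - a) / a) ^+ k) => u v w h1 h2 h3.
  by field; rewrite h1 h2 h3 C0.
under eq_bigr do rewrite term.
rewrite -mulr_sumr; apply: (mulfI st).
have := @christoffel_darboux _ _ q (functional_mul linL rho) size_exceptional_quo
  exceptional_quo_orth exceptional_quo_norm_neq0 N s t.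
rewrite -/(M _) => CD.
transitivity (kap * (rho.[s] * rho.[t]) *
   ((s - t) * \sum_(x < N.+1) (q x).[s] * (q x).[t] / M x)); first by ring.
rewrite CD.
rewrite !(lead_christoffel_quo size_P uniq_row_nodes D_neq0) size_row_nodes.
rewrite !(lead_dual_meixner a_neq0 a_neq1 c_reg) !hn !hr.
rewrite !(christoffel_polyE _ uniq_row_nodes) !hornerM OmegaE /M.
rewrite exceptional_quo_norm mulSn addSn pochhammerS !(exprD _ k2) exprS.
have := D_neq0 N; have := D_neq0 N.+1.
have := poch0 (N + k); have := c_reg (N + k); rewrite -addr_eq0.
have w0 : (a - 1) / a != 0 by rewrite mulf_neq0 ?invr_eq0.
have z0 : ((1 - a) / a) ^+ k != 0 by rewrite expf_neq0 // mulf_neq0 ?invr_eq0.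
have v0 : ((a - 1) / a) ^+ (N + k) != 0 by rewrite expf_neq0.
have e0 : (-1) ^+ k != 0 :> R by rewrite signr_eq0.
move: (ax0 (N * k2)%N) (ax0 k2) (ax0 N) (fact0 N) z0 v0 e0 st.
move: (a ^+ (N * k2)) (a ^+ k2) (a ^+ N) => u1 u2 u3.
move: (((1 - a) / a) ^+ k) (((a - 1) / a) ^+ (N + k)) ((-1) ^+ k) => u4 u5 u6.
move: (pochhammer c (N + k)) (c + (N + k)%:R) (D N) (D N.+1) => p1 p2 d1 d2.
move: (rho.[s]) (rho.[t]) (q N.+1).[s] (q N).[s] (q N.+1).[t] (q N).[t].
move=> rs rt q1 q2 q3 q4 h1 h2 h3 h4 h5 h6 h7 h8 h9 h10 h11 h12; field.
by rewrite h1 h2 h3 h4 h5 h6 h7 h8 h9 h10 h11 h12 C0 bn0 br0 aone a_neq0.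
Qed.

End Functional.
End ExceptionalAlgebra.

(** * The Gamma function *)

Section EulerGamma.
Variable R : realType.
Implicit Types (z t a b : R).
Local Notation mu := (@lebesgue_measure R).

Let gamma_fun z t : R := t `^ (z - 1) * expR (- t).

Let gamma_int z (A : set R) : \bar R := (\int[mu]_(t in A) (gamma_fun z t)%:E)%E.

Let gamma_fun_ge0 z t : 0 <= gamma_fun z t.
Proof. by rewrite mulr_ge0 ?powR_ge0 ?expR_ge0. Qed.

Let continuous_powR z t : 0 < t -> {for t, continuous (fun t : R => t `^ z)}.
Proof.
move=> t0; apply/differentiable_continuous/derivable1_diffP.
by apply: derivable_powR; rewrite in_itv/= andbT.
Qed.

Let continuous_expRN : continuous (fun t : R => expR (- t)).
Proof.
move=> t; apply: (@continuous_comp _ _ _ (@GRing.opp R) expR).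
  exact: continuousN.
exact: continuous_expR.
Qed.

Let continuous_gamma_fun z t : 0 < t -> {for t, continuous (gamma_fun z)}.
Proof.
by move=> t0; apply: continuousM; [exact: continuous_powR|exact: continuous_expRN].
Qed.

Let measurable_gamma_fun z (A : set R) : measurable A -> A `<=` `]0, +oo[ ->
  measurable_fun A (EFin \o gamma_fun z).
Proof.
move=> mA sA; apply/measurable_EFinP.
have mf : measurable_fun (`]0, +oo[%classic : set R) (gamma_fun z).
  apply: open_continuous_measurable_fun => // t.
  by rewrite inE/= in_itv/= andbT; exact: continuous_gamma_fun.
by apply: measurable_funS mf.
Qed.

Let is_derive_expRN t : is_derive t 1 (fun t : R => - expR (- t)) (expR (- t)).
Proof. by apply: is_derive_eq; rewrite mulrN1 opprK. Qed.

(** Integration by parts is done on compact intervals, away from the possible singularity at 0; the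
    intervals then exhaust the half-line. *)
Let gamma_int_parts z a b : 0 <= z -> 0 < a < b ->
  gamma_int (z + 1) `[a, b] =
  ((a `^ z * expR (- a) - b `^ z * expR (- b))%:E + z%:E * gamma_int z `[a, b])%E.
Proof.
move=> z0 /andP[a0 ab].
have b0 : 0 < b by exact: lt_trans ab.
have cab f : (forall t, 0 < t -> {for t, continuous f}) ->
    {within `[a, b], continuous (f : R -> R)}.
  move=> cf; apply: continuous_in_subspaceT => t.
  rewrite inE/= in_itv/= => /andP[at0 _]; apply: cf; exact: lt_le_trans at0.
have LR (f : R -> R) : (forall t, 0 < t -> derivable f t 1) ->
    derivable_oo_LRcontinuous f a b.
  move=> df; have cf t : 0 < t -> {for t, continuous f}.
    by move=> /df; move/derivable1_diffP/differentiable_continuous.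
  split.
  - by move=> t; rewrite in_itv/= => /andP[at0 _]; apply: df; exact: lt_trans at0.
  - by apply/cvg_at_right_filter; exact: cf.
  - by apply/cvg_at_left_filter; exact: cf.
have dE t : derivable (fun t : R => - expR (- t)) t 1 by case: (is_derive_expRN t).
have := @integration_by_parts R (fun t => t `^ z) (fun t => - expR (- t))
  (fun t => z * t `^ (z - 1)) (fun t => expR (- t)) a b ab.
move=> /(_ _)/wrap[].
  by apply: cab => t t0; apply: continuousM; [exact: cst_continuous|exact: continuous_powR].
move=> /(_ _)/wrap[].
  by apply: LR => t t0; apply: derivable_powR; rewrite in_itv/= andbT.
move=> /(_ _)/wrap[].
  move=> t; rewrite in_itv/= => /andP[at0 _]; apply: powR_derive1.
  by rewrite in_itv/= andbT; exact: lt_trans at0.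
move=> /(_ _)/wrap[]; first by apply: cab => t _; exact: continuous_expRN.
move=> /(_ _)/wrap[]; first by apply: LR => t _; exact: dE.
move=> /(_ _)/wrap[].
  by move=> t _; rewrite derive1E; case: (is_derive_expRN t).
rewrite /gamma_int /gamma_fun addrK => ->.
congr (_ + _)%E; first by congr EFin; ring.
rewrite -ge0_integralZl_EFin//=; last 2 first.
- by move=> t _; rewrite lee_fin; exact: gamma_fun_ge0.
- apply: measurable_gamma_fun => //= t /=; rewrite !in_itv/= andbT => /andP[at0 _].
  exact: lt_le_trans at0.
transitivity (- (\int[mu]_(t in `[a, b]) (- (z%:E * (t `^ (z - 1) * expR (- t))%:E))))%E.
  by congr (- _)%E; apply: eq_integral => t _; rewrite -EFinM -EFinN; congr EFin; ring.
rewrite integral_ge0N ?oppeK // => t _.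
by rewrite -EFinM lee_fin mulr_ge0 // mulr_ge0 ?powR_ge0 ?expR_ge0.
Qed.

Let itv_nat_cover : \bigcup_n `[n.+1%:R^-1, n.+1%:R]%classic = `]0, +oo[%classic :> set R.
Proof.
apply/seteqP; split => [t [n _]|t] /=; rewrite !in_itv/= andbT.
  by move=> /andP[+ _]; apply: lt_le_trans; rewrite invr_gt0.
move=> t0; pose m := maxn (Num.bound t) (Num.bound t^-1); exists m => //=.
have tb : t <= m.+1%:R.
  apply: (le_trans (ltW (archi_boundP (ltW t0)))).
  by rewrite ler_nat (leq_trans (leq_maxl _ (Num.bound t^-1))).
have ti : t^-1 <= m.+1%:R.
  apply: (le_trans (ltW (archi_boundP _))); first by rewrite invr_ge0 ltW.
  by rewrite ler_nat (leq_trans (leq_maxr (Num.bound t) _)).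
by rewrite in_itv/= tb andbT -[t]invrK lef_pV2 ?posrE ?invr_gt0.
Qed.

Let gamma_int_cvg z : gamma_int z `[n.+1%:R^-1, n.+1%:R] @[n --> \oo] -->
  gamma_int z `]0, +oo[.
Proof.
rewrite -itv_nat_cover; apply: ge0_nondecreasing_set_cvg_integral => //.
- move=> n m lenm; rewrite subsetEset => t /=; rewrite !in_itv/= => /andP[h1 h2].
  apply/andP; split; last by rewrite (le_trans h2) // ler_nat.
  by rewrite (le_trans _ h1) // lef_pV2 ?posrE // ler_nat.
- move=> n; apply: measurable_gamma_fun => // t /=; rewrite !in_itv/= andbT.
  by move=> /andP[+ _]; apply: lt_le_trans; rewrite invr_gt0.
- by move=> n t _; rewrite lee_fin gamma_fun_ge0.
Qed.

Let boundary_right z : 0 < z ->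
  n.+1%:R `^ z * expR (- n.+1%:R) @[n --> \oo] --> (0 : R).
Proof.
move=> z0; pose m := Num.bound z.
have zm : z <= m%:R by apply/ltW/archi_boundP/ltW.
apply: (@squeeze_cvgr _ _ _ _ (fun=> 0) (fun n => m.+1`!%:R * harmonic n)).
- apply: nearW => n; rewrite mulr_ge0 ?powR_ge0 ?expR_ge0 //=.
  have b1 : 1 <= n.+1%:R :> R by rewrite ler1n.
  have b0 : 0 < n.+1%:R :> R by [].
  (* With z <= m, the bound e^t >= t^(m+1) / (m+1)! leaves (m+1)! / t. *)
  apply: (@le_trans _ _ (n.+1%:R ^+ m / (n.+1%:R ^+ m.+1 / m.+1`!%:R))).
    apply: ler_pM; rewrite ?powR_ge0 ?expR_ge0 //.
      by rewrite -powR_mulrn // ler_powR.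
    rewrite expRN lef_pV2 ?posrE ?expR_gt0 ?divr_gt0 ?exprn_gt0 ?ltr0n ?fact_gt0 //.
    by apply: le_trans (expR_ge1Dxn m (ltW b0)); rewrite lerDr.
  have := expf_neq0 m (lt0r_neq0 b0); rewrite exprS /harmonic.
  move: (n.+1%:R ^+ m) => u u0; rewrite le_eqVlt; apply/orP; left; apply/eqP.
  by field; rewrite u0 lt0r_neq0 //= lt0r_neq0 // ltr0n fact_gt0.
- exact: cvg_cst.
- rewrite -[X in _ --> X](mulr0 (m.+1`!%:R : R)); apply: cvgMr; exact: cvg_harmonic.
Qed.

Let boundary_left z : 0 < z ->
  n.+1%:R^-1 `^ z * expR (- n.+1%:R^-1) @[n --> \oo] --> (0 : R).
Proof.
move=> z0.
apply: (@squeeze_cvgr _ _ _ _ (fun=> 0) (fun n => n.+1%:R^-1 `^ z)).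
- apply: nearW => n; rewrite mulr_ge0 ?powR_ge0 ?expR_ge0 //=.
  by rewrite ler_piMr ?powR_ge0 // -expR0 ler_expR oppr_le0 invr_ge0.
- exact: cvg_cst.
- have /cvg_at_rightP := powR_cvg0 z0; apply; split => //.
  exact: cvg_harmonic.
Qed.

Let EG z : \bar R := gamma_int z `]0, +oo[.

(** Stated in the extended reals, so that it holds before finiteness is known and can be used to
    derive it. *)
Let EG_rec z : 0 < z -> EG (z + 1) = (z%:E * EG z)%E.
Proof.
move=> z0; pose B n : R := n.+1%:R^-1 `^ z * expR (- n.+1%:R^-1) -
     n.+1%:R `^ z * expR (- n.+1%:R).
have hB : (B n)%:E @[n --> \oo] --> 0%E.
  apply: cvg_EFin; first exact: nearW.
  by rewrite -[0]subr0; apply: cvgB; [exact: boundary_left|exact: boundary_right].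
have f0 : (0 : \bar R) \is a fin_num by [].
have fz : z%:E \is a fin_num by [].
have h2 := @cvgeD _ _ eventually_filter _ _ _ _ _ (fin_num_adde_defr _ f0) hB (cvgeZl fz (@gamma_int_cvg z)).
rewrite add0e in h2.
have h3 : gamma_int (z + 1) `[n.+1%:R^-1, n.+1%:R] @[n --> \oo] --> (z%:E * EG z)%E.
  apply: cvg_trans h2; apply: near_eq_cvg; near=> n.
  rewrite gamma_int_parts ?(ltW z0) //.
  have n1 : 1 < n.+1%:R :> R by rewrite ltr1n ltnS; near: n; exists 1%N.
  by rewrite invr_gt0 ltr0n /= (lt_trans _ n1) // invf_lt1.
exact: (cvg_unique _ (@gamma_int_cvg (z + 1)) h3).
Unshelve. all: by end_near. Qed.

Let EG_ge0 z : (0 <= EG z)%E.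
Proof. by apply: integral_ge0 => t _; rewrite lee_fin gamma_fun_ge0. Qed.

Let EG1 : EG 1 = 1%E.
Proof.
rewrite /EG /gamma_int /gamma_fun subrr.
under eq_integral => t _ do rewrite powRr0 mul1r.
rewrite integral_itv_obnd_cbnd //; last first.
  apply/measurable_EFinP/measurable_funTS; apply: continuous_measurable_fun.
  exact: continuous_expRN.
rewrite (@ge0_continuous_FTC2y _ _ (fun t => - expR (- t)) _ 0).
- by rewrite oppr0 expR0 EFinN oppeK add0e.
- by move=> t _; exact: expR_ge0.
- exact/continuous_subspaceT/continuous_expRN.
- by rewrite -oppr0; apply: cvgN; exact: cvgr_expR.
- by move=> t _; case: (is_derive_expRN t).
- by apply: cvg_at_right_filter; apply: cvgN; exact: continuous_expRN.
- by move=> t _; rewrite derive1E; case: (is_derive_expRN t).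
Qed.

Let EG_nat n : EG n.+1%:R = n`!%:R%:E.
Proof.
elim: n => [|n IH]; first exact: EG1.
by rewrite -natr1 EG_rec ?ltr0n // IH -EFinM -natrM -factS.
Qed.

Let EG_fin z : 0 < z -> EG z \is a fin_num.
Proof.
(* An infinite value at z would propagate to z + 1. There t^z <= 1 + t^m, so the integral is at most
   the sum of those at 1 and m + 1, both factorials. *)
move=> z0; suff h : (EG (z + 1) < +oo)%E.
  rewrite ge0_fin_numE // ltNge leye_eq; apply/negP => /eqP zoo.
  by move: h; rewrite EG_rec // zoo gt0_muley ?lte_fin // ltxx.
pose m := Num.bound z.
have zm : z <= m%:R by apply/ltW/archi_boundP/ltW.
have mf u : measurable_fun (`]0, +oo[%classic : set R) (EFin \o gamma_fun u).
  exact: measurable_gamma_fun.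
apply: (@le_lt_trans _ _ (EG 1 + EG m.+1%:R)%E); last first.
  by rewrite EG1 EG_nat -EFinD ltry.
rewrite -ge0_integralD //; try by move=> t _; rewrite lee_fin gamma_fun_ge0.
- apply: ge0_le_integral => //.
  + by move=> t _; rewrite lee_fin gamma_fun_ge0.
  + exact: mf.
  + by apply: emeasurable_funD; exact: mf.
  + move=> t /=; rewrite in_itv/= andbT => t0.
    rewrite -EFinD lee_fin /gamma_fun -mulrDl ler_pM2r ?expR_gt0 //.
    rewrite addrK subrr powRr0 -natr1 addrK.
    have [t1|t1] := leP t 1.
      rewrite (le_trans (y := 1)) ?lerDl ?powR_ge0 //.
      have := ge0_ler_powR (ltW z0) (x := t) (y := 1).
      by rewrite powR1 !nnegrE (ltW t0) ler01; exact.
    by rewrite (le_trans (y := t `^ m%:R)) ?lerDr // ler_powR // ltW.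
- exact: mf.
- exact: mf.
Qed.

Let EG_gamma z : euler_gamma z = fine (EG z). Proof. by []. Qed.

Lemma euler_gammaS z : 0 < z -> euler_gamma (z + 1) = z * euler_gamma z.
Proof. by move=> z0; rewrite !EG_gamma EG_rec // fineM // EG_fin. Qed.

Lemma euler_gamma_gt0 z : 0 < z -> 0 < euler_gamma z.
Proof.
(* At z + 1 the exponent is positive, so the integrand is at least e^(-2) on [1, 2]. *)
move=> z0; suff h : 0 < euler_gamma (z + 1).
  by move: h; rewrite euler_gammaS // pmulr_rgt0.
have EGz : EG (z + 1) \is a fin_num by rewrite EG_fin // addr_gt0.
rewrite EG_gamma -lte_fin fineK //.
apply: (@lt_le_trans _ _ (expR (- 2))%:E); first by rewrite lte_fin expR_gt0.
apply: (@le_trans _ _ (gamma_int (z + 1) `[1, 2])); last first.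
  apply: ge0_subset_integral => //.
  - exact: measurable_gamma_fun.
  - by move=> t _; rewrite lee_fin gamma_fun_ge0.
  - move=> t /=; rewrite !in_itv/= andbT => /andP[+ _]; exact: lt_le_trans.
rewrite -[leLHS]mule1 (_ : 1%E = mu `[1, 2]); last first.
  by rewrite lebesgue_measure_itv /= lte_fin ltr1n -EFinB; congr EFin; ring.
rewrite -integral_cst //=; apply: ge0_le_integral => //.
- apply: measurable_gamma_fun => // t /=; rewrite !in_itv/= andbT => /andP[+ _].
  exact: lt_le_trans.
- move=> t /=; rewrite in_itv/= => /andP[t1 t2].
  rewrite lee_fin /gamma_fun addrK -[leLHS]mul1r ler_pM ?expR_ge0 //.
    by rewrite -(powRr0 t) ler_powR // ltW.
  by rewrite ler_expR lerN2.
Qed.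

End EulerGamma.

(** * Gamma at negative arguments and admissibility *)

Section GammaRecurrence.
Variable R : realType.
Implicit Types z c : R.

Let hat_pos z : 0 < z -> hat z = 0%N.
Proof.
move=> z0; rewrite /hat; have : 0 <= Num.floor z by rewrite floor_ge0 ltW.
by move=> h; rewrite max_r // oppr_le0.
Qed.

Let hat_neg z : z < 0 -> hat z = (hat (z + 1)).+1.
Proof.
move=> z0; rewrite /hat floorDrz // floor1.
have : Num.floor z < 0 by rewrite floor_lt0.
move: (Num.floor z) => f f0.
rewrite !max_l; lia.
Qed.

Let neq0_or c : (forall n : nat, c != - n%:R) -> 0 < c \/ c < 0.
Proof.
by move=> hc; case: (ltgtP 0 c) => [||e]; [left|right|have := hc 0%N; rewrite -e oppr0 eqxx].
Qed.

(** For c < 0 both sides use Euler's integral at the same point, since [hat] drops by one when c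
    grows by one; only the Pochhammer factors differ. *)
Lemma GammaS c : (forall n : nat, c != - n%:R) -> Gamma (c + 1) = c * Gamma c.
Proof.
move=> hc; case: (neq0_or hc) => c0.
  rewrite /Gamma !hat_pos ?addr_gt0 // !pochhammer0 !divr1 !addr0.
  exact: euler_gammaS.
rewrite /Gamma (hat_neg c0) pochhammerSl -natr1 [_%:R + 1]addrC addrA invfM.
by rewrite mulrCA [c * _]mulrA mulfV ?lt_eqF // mul1r.
Qed.

Lemma GammaD c n : (forall m : nat, c != - m%:R) ->
  Gamma (c + n%:R) = Gamma c * pochhammer c n.
Proof.
move=> hc; elim: n => [|n IH]; first by rewrite addr0 pochhammer0 mulr1.
rewrite -natr1 addrA GammaS; first by rewrite IH pochhammerS; ring.
by move=> m; rewrite -subr_eq0 opprK -addrA -natrD addr_eq0.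
Qed.

Lemma Gamma_gt0 c : 0 < c -> 0 < Gamma c.
Proof.
by move=> c0; rewrite /Gamma hat_pos // pochhammer0 divr1 addr0 euler_gamma_gt0.
Qed.

Lemma addr_hat_gt0 c : (forall n : nat, c != - n%:R) -> 0 < c + (hat c)%:R.
Proof.
move=> hc; case: (neq0_or hc) => c0; first by rewrite hat_pos // addr0.
have f0 : Num.floor c < 0 by rewrite floor_lt0.
have E : - (hat c)%:R = (Num.floor c)%:~R :> R.
  rewrite /hat max_l; last by lia.
  by rewrite -[LHS]opprK -[(Num.floor c)]opprK; case: (Num.floor c) f0 => // m _;
    rewrite NegzE !opprK absz_nat rmorphN.
have := floor_le c; rewrite -E le_eqVlt => /orP[/eqP h|].
  by have := hc (hat c); rewrite h eqxx.
by rewrite -subr_gt0 opprK.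
Qed.

(* Gamma(x + c) times (x + c)_hat is a value of Gamma at a positive argument. *)
Lemma admissibleE c (F1 F2 : {fset nat}) : (forall n : nat, c != - n%:R) ->
  admissible c F1 F2 <-> forall x : nat,
    0 <= Gamma c * pochhammer c x * (\prod_(f <- enum_fset F1) (x%:R - f%:R) *
      \prod_(f <- enum_fset F2) (x%:R + c + f%:R)).
Proof.
move=> hc; suff E (x : nat) (X : R) : (0 <= X / pochhammer (x%:R + c) (hat c)) =
    (0 <= Gamma c * pochhammer c x * X).
  by split => h x; have := h x; rewrite E.
rewrite -GammaD // [x%:R + c]addrC; have cx m : c + x%:R != - m%:R.
  by rewrite -subr_eq0 opprK -addrA -natrD addr_eq0.
have pos : 0 < Gamma (c + x%:R) * pochhammer (c + x%:R) (hat c).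
  by rewrite -GammaD // Gamma_gt0 // addrAC ltr_wpDr // addr_hat_gt0.
rewrite -(pmulr_lge0 _ pos); congr (0 <= _).
by field; rewrite pochhammer_neq0.
Qed.

End GammaRecurrence.

(** * Polynomial growth and summation *)

Section PolynomialFunctions.
Variable R : realType.
Implicit Types (f g : R -> R).

Definition polyfun f := exists p : {poly R}, forall x, f x = p.[x].

Lemma polyfun_cst b : polyfun (fun=> b).
Proof. by exists b%:P => x; rewrite hornerC. Qed.

Lemma polyfun_id : polyfun id.
Proof. by exists 'X => x; rewrite hornerX. Qed.

Lemma polyfunD f g : polyfun f -> polyfun g -> polyfun (fun x => f x + g x).
Proof. by move=> [p hp] [q hq]; exists (p + q) => x; rewrite hornerD hp hq. Qed.

Lemma polyfunM f g : polyfun f -> polyfun g -> polyfun (fun x => f x * g x).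
Proof. by move=> [p hp] [q hq]; exists (p * q) => x; rewrite hornerM hp hq. Qed.

Lemma polyfun_comp f g : polyfun f -> polyfun g -> polyfun (f \o g).
Proof.
by move=> [p hp] [q hq]; exists (p \Po q) => x; rewrite /= horner_comp hp hq.
Qed.

Lemma polyfun_sum (I : Type) (r : seq I) (P : pred I) (F : I -> R -> R) :
  (forall i, polyfun (F i)) -> polyfun (fun x => \sum_(i <- r | P i) F i x).
Proof.
move=> hF; elim: r => [|i r [p hp]].
  by exists 0 => x; rewrite big_nil horner0.
have [q hq] := hF i; exists (if P i then q + p else p) => x.
by rewrite big_cons; case: (P i); rewrite ?hornerD hp ?hq.
Qed.

Lemma polyfun_prod (I : Type) (r : seq I) (P : pred I) (F : I -> R -> R) :
  (forall i, polyfun (F i)) -> polyfun (fun x => \prod_(i <- r | P i) F i x).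
Proof.
move=> hF; elim: r => [|i r [p hp]].
  by exists 1 => x; rewrite big_nil hornerC.
have [q hq] := hF i; exists (if P i then q * p else p) => x.
by rewrite big_cons; case: (P i); rewrite ?hornerM hp ?hq.
Qed.

Lemma polyfun_det n (M : R -> 'M[R]_n) :
  (forall i j, polyfun (fun x => M x i j)) -> polyfun (fun x => \det (M x)).
Proof.
move=> hM; apply: polyfun_sum => s; apply: polyfunM; first exact: polyfun_cst.
by apply: polyfun_prod.
Qed.

Lemma polyfun_det_rows n (s : R -> seq (nat -> R)) :
  (forall x, size (s x) = n) ->
  (forall i j, polyfun (fun x => nth (fun=> 0) (s x) i j)) ->
  polyfun (fun x => det_rows (s x)).
Proof.
move=> sz hs; pose M x : 'M[R]_n := \matrix_(i < n, j < n) nth (fun=> 0) (s x) i j.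
have [|p hp] := @polyfun_det n M.
  by move=> i j; have [p hp] := hs i j; exists p => x; rewrite mxE.
by exists p => x; rewrite (det_rowsE (sz x)) -hp.
Qed.

Lemma polyfun_gbinom j : polyfun (fun x => gbinom x j).
Proof.
apply: polyfunM; last exact: polyfun_cst.
by apply: polyfun_prod => i; exact: polyfunD polyfun_id (polyfun_cst _).
Qed.

Lemma polyfun_meixner a c n : polyfun (meixner a c n).
Proof.
apply: polyfunM; first exact: polyfun_cst.
apply: polyfun_sum => j; apply: polyfunM; last first.
  apply: (polyfun_comp (polyfun_gbinom _) (g := fun x => - x - c)).
  apply: polyfunD; last exact: polyfun_cst.
  by exists (- 'X) => x; rewrite hornerN hornerX.
apply: polyfunM; [exact: polyfun_cst|exact: polyfun_gbinom].
Qed.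

Let polyfun_meixner_shift a c n (j : nat) : polyfun (fun x => meixner a c n (x + j%:R)).
Proof.
apply: (polyfun_comp (polyfun_meixner _ _ _) (g := fun x => x + j%:R)).
exact: polyfunD polyfun_id (polyfun_cst _).
Qed.

Let size_F_rows (a c : R) (F1 F2 : {fset nat}) x :
  size (F_rows a c F1 F2 x) = nF F1 F2 :> nat.
Proof. by rewrite size_cat !size_map !size_sort. Qed.

Let polyfun_F_rows (a c : R) (F1 F2 : {fset nat}) i j :
  polyfun (fun x : R => nth (fun=> 0) (F_rows a c F1 F2 x) i j).
Proof.
have [lti|lei] := ltnP i (nF F1 F2); last first.
  by exists 0 => x; rewrite nth_default ?size_F_rows // horner0.
rewrite /F_rows.
have [h|h] := ltnP i (size (sort leq (enum_fset F1))).
  have [p hp] := @polyfun_meixner_shift a c (nth 0%N (sort leq (enum_fset F1)) i) j.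
  by exists p => x; rewrite nth_cat size_map h (nth_map 0%N).
have [p hp] := polyfunM (@polyfun_meixner_shift a^-1 c
  (nth 0%N (sort leq (enum_fset F2)) (i - size (sort leq (enum_fset F1)))) j)
  (polyfun_cst (a ^- j)).
exists p => x; rewrite nth_cat size_map ltnNge h /= (nth_map 0%N) //.
by rewrite ltn_subLR // !size_sort.
Qed.

Lemma polyfun_OmegaF (a c : R) (F1 F2 : {fset nat}) : polyfun (OmegaF a c F1 F2).
Proof. exact: (polyfun_det_rows (size_F_rows _ _ _ _)). Qed.

Lemma polyfun_meixnerF (a c : R) (F1 F2 : {fset nat}) n : polyfun (meixnerF a c F1 F2 n).
Proof.
apply: (@polyfun_det_rows (nF F1 F2).+1) => [x|[|i] j] /=.
- by rewrite size_F_rows.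
- exact: polyfun_meixner_shift.
- exact: polyfun_F_rows.
Qed.

Lemma polyfun_continuous f : polyfun f -> continuous f.
Proof.
move=> [p hp]; have -> : f = horner p by apply/funext.
exact: continuous_horner.
Qed.

Let poly_eventually (p : {poly R}) : p != 0 -> exists2 b, b != 0 &
  exists N : nat, forall n : nat, (N <= n)%N -> `|b| <= `|p.[n%:R]| /\ 0 < b * p.[n%:R].
Proof.
have pos (q : {poly R}) : 0 < lead_coef q ->
    exists N : nat, forall n : nat, (N <= n)%N -> lead_coef q <= q.[n%:R].
  move=> /polyrcf.poly_pinfty_gt_lc[y hy]; exists (Num.bound `|y|) => n leNn.
  apply: hy; rewrite (le_trans (ler_norm y)) // ltW //.
  by rewrite (lt_le_trans (archi_boundP (normr_ge0 y))) // ler_nat.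
move=> p0; exists (lead_coef p); first by rewrite lead_coef_eq0.
case: (ltgtP 0 (lead_coef p)) => h; last 1 first.
- by move: p0; rewrite -lead_coef_eq0 -h eqxx.
- have [N hN] := pos _ h; exists N => n /hN hn.
  have pn := lt_le_trans h hn.
  by rewrite !gtr0_norm // hn mulr_gt0.
- have h' : 0 < lead_coef (- p) by rewrite lead_coefN oppr_gt0.
  have [N hN] := pos _ h'; exists N => n /hN; rewrite lead_coefN hornerN lerN2 => hn.
  have pn := le_lt_trans hn h.
  by rewrite !ltr0_norm // lerN2 hn nmulr_rgt0.
Qed.

Lemma polyfun_same_sign f : polyfun f -> (forall n : nat, f n%:R != 0) ->
  exists N : nat, forall n : nat, (N <= n)%N -> 0 < f n%:R * f n.+1%:R.
Proof.
move=> [p hp] f0; have p0 : p != 0.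
  by apply/eqP => p0; have := f0 0%N; rewrite hp p0 horner0 eqxx.
have [b b0 [N hN]] := poly_eventually p0; exists N => n leNn; rewrite !hp.
have [_ h1] := hN n leNn; have [_ h2] := hN n.+1 (leqW leNn).
have := mulr_gt0 h1 h2; rewrite mulrACA pmulr_rgt0 //.
by rewrite -expr2 lt0r sqrf_eq0 b0 sqr_ge0.
Qed.

(** From some index on |f| exceeds its leading coefficient in absolute value; the finitely many
    earlier values contribute their minimum. *)
Lemma polyfun_bounded_below f : polyfun f -> (forall n : nat, f n%:R != 0) ->
  exists2 e, 0 < e & forall n : nat, e <= `|f n%:R|.
Proof.
move=> [p hp] f0; have p0 : p != 0.
  by apply/eqP => p0; have := f0 0%N; rewrite hp p0 horner0 eqxx.
have [b b0 [N hN]] := poly_eventually p0.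
have [e e0 he] : exists2 e, 0 < e & forall n : nat, (n < N)%N -> e <= `|f n%:R|.
  elim: N {hN} => [|N [e e0 he]]; first by exists 1.
  exists (Num.min e `|f N%:R|) => [|n]; first by rewrite lt_min e0 normr_gt0 f0.
  rewrite ltnS leq_eqVlt => /orP[/eqP->|/he h]; rewrite ge_min ?lexx ?orbT //.
  by rewrite h.
exists (Num.min e `|b|) => [|n]; first by rewrite lt_min e0 normr_gt0.
rewrite ge_min; have [/he->//|/hN[h _]] := ltnP n N.
by rewrite hp h orbT.
Qed.

End PolynomialFunctions.

(** * Sequences growing slower than every geometric one *)

Section Subexponential.
Variable R : realType.
Implicit Types (u v w : nat -> R) (q : R).

(** One class, closed under sums and products, holding polynomials, (c)_n / n! and 1/Omega; a factor
    a^n with |a| < 1 beats all of it, with no exponents to track. *)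
Definition subexp v := forall q, 1 < q -> exists C, forall n, `|v n| <= C * q ^+ n.

Lemma subexp_cst b : subexp (fun=> b).
Proof.
move=> q q1; exists `|b| => n; rewrite ler_peMr ?normr_ge0 //.
by rewrite exprn_ege1 // ltW.
Qed.

Lemma subexp_le v w : (forall n, `|v n| <= `|w n|) -> subexp w -> subexp v.
Proof. by move=> h hw q /hw[C hC]; exists C => n; exact: le_trans (hC n). Qed.

Lemma subexpD v w : subexp v -> subexp w -> subexp (fun n => v n + w n).
Proof.
move=> hv hw q q1; have [C hC] := hv q q1; have [D hD] := hw q q1.
exists (C + D) => n; rewrite mulrDl (le_trans (ler_normD _ _)) //.
exact: lerD.
Qed.

Lemma subexpM v w : subexp v -> subexp w -> subexp (fun n => v n * w n).
Proof.
move=> hv hw q q1.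
have s1 : 1 < Num.sqrt q by rewrite -sqrtr1 ltr_sqrt // (lt_trans ltr01).
have [C hC] := hv _ s1; have [D hD] := hw _ s1.
exists (C * D) => n; rewrite normrM.
have -> : q ^+ n = Num.sqrt q ^+ n * Num.sqrt q ^+ n.
  by rewrite -exprMn -expr2 sqr_sqrtr // ltW // (lt_trans ltr01).
by rewrite mulrACA ler_pM.
Qed.

Lemma subexp_ratio v : (forall q, 1 < q -> exists N, forall n, (N <= n)%N ->
  `|v n.+1| <= q * `|v n|) -> subexp v.
Proof.
move=> h q q1; have [N hN] := h q q1.
have q0 : 0 < q by exact: lt_trans q1.
(* This sum dominates each of the values before the ratio bound takes effect. *)
exists (\sum_(i < N.+1) `|v i|) => n.
have S0 : 0 <= \sum_(i < N.+1) `|v i| by apply: sumr_ge0.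
have [lenN|ltNn] := leqP n N.
  apply: (@le_trans _ _ (\sum_(i < N.+1) `|v i|)); last first.
    by rewrite ler_peMr // exprn_ege1 // ltW.
  rewrite (bigD1 (Ordinal (lenN : (n < N.+1)%N))) //= lerDl.
  by apply: sumr_ge0.
have vN : `|v N| <= \sum_(i < N.+1) `|v i|.
  by rewrite big_ord_recr /= lerDr; apply: sumr_ge0.
have -> : n = (N + (n - N))%N by rewrite subnKC // ltnW.
elim: (n - N)%N => [|m IH]; rewrite ?addn0.
  by rewrite (le_trans vN) // ler_peMr // exprn_ege1 // ltW.
rewrite addnS (le_trans (hN _ (leq_addr _ _))) // exprS mulrCA.
by rewrite ler_pM2l.
Qed.

Lemma subexp_nat : subexp (fun n => n%:R).
Proof.
apply: subexp_ratio => q q1; have d0 : 0 < q - 1 by rewrite subr_gt0.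
exists (Num.bound (q - 1)^-1) => n leNn; rewrite !ger0_norm //.
have : (q - 1)^-1 <= n%:R.
  rewrite ltW // (lt_le_trans (archi_boundP _)) ?ler_nat // invr_ge0 ltW //.
rewrite -(ler_pM2l d0) mulfV ?lt0r_neq0 // mulrBl mul1r => h.
by rewrite -natr1 -lerBrDl.
Qed.

Lemma subexp_poly (p : {poly R}) : subexp (fun n => p.[n%:R]).
Proof.
elim/poly_ind: p => [|p b IH].
  by move=> q q1; exists 0 => n; rewrite horner0 normr0 mul0r.
have := subexpD (subexpM IH subexp_nat) (subexp_cst b).
by apply: subexp_le => n; rewrite !hornerE.
Qed.

Lemma subexp_polyfun f : polyfun f -> subexp (fun n => f n%:R).
Proof. by move=> [p hp]; apply: subexp_le (subexp_poly p) => n; rewrite hp. Qed.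

Lemma subexp_shift v k : subexp v -> subexp (fun n => v (n + k)%N).
Proof.
move=> hv q q1; have [C hC] := hv q q1; exists (C * q ^+ k) => n.
by rewrite -mulrA -exprD [(k + n)%N]addnC.
Qed.

Lemma subexp_inv v e : 0 < e -> (forall n, e <= `|v n|) -> subexp (fun n => (v n)^-1).
Proof.
move=> e0 he; apply: subexp_le (subexp_cst e^-1) => n.
by rewrite !normfV lef_pV2 ?posrE ?(gtr0_norm e0) // (lt_le_trans e0).
Qed.

(** Consecutive terms have ratio (c + k + n) / (n + 1), which tends to 1. *)
Lemma subexp_pochhammer c k : subexp (fun n => pochhammer c (n + k) / n`!%:R).
Proof.
apply: subexp_ratio => q q1; have d0 : 0 < q - 1 by rewrite subr_gt0.
exists (Num.bound (`|c + k%:R| / (q - 1))) => n leNn.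
have h : `|c + k%:R| <= (q - 1) * n%:R.
  rewrite mulrC -ler_pdivrMr // ltW // (lt_le_trans (archi_boundP _)) ?ler_nat //.
  by rewrite divr_ge0 // ltW.
rewrite addSn pochhammerS factS natrM invfM.
have -> : pochhammer c (n + k) * (c + (n + k)%:R) * (n.+1%:R^-1 * n`!%:R^-1) =
  (c + (n + k)%:R) / n.+1%:R * (pochhammer c (n + k) / n`!%:R) by ring.
rewrite normrM ler_wpM2r // normrM normfV [ `|n.+1%:R|]ger0_norm //.
rewrite ler_pdivrMr ?ltr0n // natrD [n%:R + _]addrC addrA.
rewrite (le_trans (ler_normD _ _)) // [ `|n%:R|]ger0_norm //.
rewrite (le_trans (lerD h (lexx _))) // mulrBl mul1r subrK -natr1 mulrDr mulr1.
by rewrite lerDl ltW // (lt_trans ltr01).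
Qed.

Lemma subexp_geometric a v : `|a| < 1 -> subexp v ->
  exists C r, [/\ 0 <= C, 0 <= r < 1 & forall n, `|a ^+ n * v n| <= C * r ^+ n].
Proof.
(* This q exceeds 1 while q |a| is still below 1. *)
move=> a1 hv; pose q := 2 / (1 + `|a|).
have p1 : 0 < 1 + `|a| by rewrite ltr_wpDr.
have q1 : 1 < q by rewrite /q ltr_pdivlMr // mul1r; lra.
have [C hC] := hv q q1; exists C, (q * `|a|); split.
- by have := hC 0%N; rewrite expr0 mulr1; apply: le_trans.
- rewrite mulr_ge0 ?divr_ge0 //= ?(ltW p1) //.
  by rewrite /q mulrAC ltr_pdivrMr // mul1r; lra.
- move=> n; rewrite normrM normrX exprMn mulrC mulrA ler_wpM2r //.
Qed.

Lemma subexp_geometric_cvg0 a v : `|a| < 1 -> subexp v ->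
  a ^+ n * v n @[n --> \oo] --> (0 : R).
Proof.
move=> a1 /(subexp_geometric a1)[C [r [C0 /andP[r0 r1] h]]].
apply/norm_cvg0P; apply: (@squeeze_cvgr _ _ _ _ (fun=> 0) (fun n => C * r ^+ n)).
- by apply: nearW => n; rewrite normr_ge0 h.
- exact: cvg_cst.
- rewrite -[X in _ --> X](mulr0 C); apply: cvgMr; apply: cvg_expr.
  by rewrite ger0_norm.
Qed.

Lemma subexp_geometric_norm_cvg a v : `|a| < 1 -> subexp v ->
  cvgn (series (fun n => `|a ^+ n * v n|)).
Proof.
move=> a1 /(subexp_geometric a1)[C [r [C0 /andP[r0 r1] h]]].
apply: (series_le_cvg (v_ := fun n => C * r ^+ n)) => //.
- by move=> n; rewrite mulr_ge0 // exprn_ge0.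
- by apply: is_cvg_geometric_series; rewrite ger0_norm.
Qed.

Lemma subexp_geometric_cvg a v : `|a| < 1 -> subexp v ->
  cvgn (series (fun n => a ^+ n * v n)).
Proof.
by move=> a1 hv; apply: normed_cvg; exact: subexp_geometric_norm_cvg.
Qed.

End Subexponential.

Lemma eq_functional (F : fieldType) (b : nat -> {poly F}) (L M : {poly F} -> F) :
  functional L -> functional M -> (forall n, size (b n) = n.+1) ->
  (forall n, L (b n) = M (b n)) -> forall p, L p = M p.
Proof.
move=> linL linM size_b LM p; have [n /ltnW] := ubnP (size p).
elim: n p => [|n IH] p.
  by rewrite leqn0 size_poly_eq0 => /eqP->; rewrite !functional0.
move=> /(graded_split size_b) /IH.
by rewrite !functionalB // !functionalZ // LM => /addIr.
Qed.

(** * The Meixner weight as a convergent series, and its total mass *)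

Section MeixnerSeries.
Variables (R : realType) (a c : R).
Hypothesis a_lt1 : `|a| < 1.

Definition meixner_weight (s : nat) : R := a ^+ s * (pochhammer c s / s`!%:R).
Local Notation w := meixner_weight.

Lemma subexp_meixner_coef : subexp (fun s => pochhammer c s / s`!%:R).
Proof.
by apply: subexp_le (subexp_pochhammer c 0) => n; rewrite addn0.
Qed.

Lemma meixner_weightS s : s.+1%:R * w s.+1 = a * (c + s%:R) * w s.
Proof.
rewrite /w exprS pochhammerS factS natrM invfM.
have : s.+1%:R != 0 :> R by [].
by move: (s.+1%:R : R) => t t0; field; rewrite t0 pnatr_eq0 -lt0n fact_gt0.
Qed.

Let wE (p : {poly R}) s : w s * p.[s%:R] =
  a ^+ s * (pochhammer c s / s`!%:R * p.[s%:R]).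
Proof. by rewrite /meixner_weight -!mulrA. Qed.

Let sub_wp (p : {poly R}) : subexp (fun s => pochhammer c s / s`!%:R * p.[s%:R]).
Proof. exact: subexpM subexp_meixner_coef (subexp_poly p). Qed.

Lemma meixner_series_cvg (p : {poly R}) : cvgn (series (fun s => w s * p.[s%:R])).
Proof.
have -> : (fun s => w s * p.[s%:R]) =
    (fun s => a ^+ s * (pochhammer c s / s`!%:R * p.[s%:R])).
  by apply/funext => s; rewrite wE.
exact: subexp_geometric_cvg.
Qed.

Definition meixner_sum (p : {poly R}) : R := limn (series (fun s => w s * p.[s%:R])).

Lemma meixner_sum_cvg (p : {poly R}) :
  series (fun s => w s * p.[s%:R]) n @[n --> \oo] --> meixner_sum p.
Proof. exact: meixner_series_cvg. Qed.

Lemma meixner_sum_functional : functional meixner_sum.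
Proof.
move=> b p q; apply/cvg_lim => //.
have -> : series (fun s => w s * (b *: p + q).[s%:R]) =
    (fun n => b * series (fun s => w s * p.[s%:R]) n + series (fun s => w s * q.[s%:R]) n).
  apply/funext => n; rewrite /series /= mulr_sumr -big_split /=.
  by apply: eq_bigr => i _; rewrite hornerD hornerZ; ring.
by apply: cvgD; [apply: cvgMr|]; exact: meixner_sum_cvg.
Qed.

(* Summation by parts against the Pearson relation [meixner_weightS]. *)
Lemma meixner_sum_ffact j : (1 - a) * meixner_sum (ffact_poly R j.+1) =
  a * (c + j%:R) * meixner_sum (ffact_poly R j).
Proof.
pose S k n := series (fun s => w s * (ffact_poly R k).[s%:R]) n.
(* An exact identity for partial sums; the last term is the boundary term, zero at n = 0 and
   vanishing in the limit. *)
have rec n : (1 - a) * S j.+1 n =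
    a * (c + j%:R) * S j n - a ^+ n * (n%:R * (pochhammer c n / n`!%:R * (ffact_poly R j).[n%:R - 1])).
  elim: n => [|n IH]; first by rewrite /S /series /= !big_geq // mul0r !mulr0 subrr.
  rewrite /S !seriesSr !mulrDr -!/(S _ _) IH.
  have -> : a ^+ n.+1 * (n.+1%:R * (pochhammer c n.+1 / n.+1`!%:R *
      (ffact_poly R j).[n.+1%:R - 1])) = (n.+1%:R * w n.+1) * (ffact_poly R j).[n%:R].
    by rewrite -natr1 addrK natr1 /w; ring.
  rewrite meixner_weightS horner_ffact_polyS.
  have -> : a ^+ n * (n%:R * (pochhammer c n / n`!%:R * (ffact_poly R j).[n%:R - 1])) =
    w n * (n%:R * (ffact_poly R j).[n%:R - 1]) by rewrite /w; ring.
  have -> : n%:R * (ffact_poly R j).[n%:R - 1] = (ffact_poly R j).[n%:R] * (n%:R - j%:R).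
    have h (x : R) : x * (ffact_poly R j).[x - 1] = (ffact_poly R j).[x] * (x - j%:R).
      rewrite -horner_ffact_polyS !horner_ffact_poly_gbinom.
      have := gbinomSl (x - 1) j; rewrite subrK => ->; rewrite factS natrM.
      have : j.+1%:R != 0 :> R by [].
      by move: (j.+1%:R : R) => t t0; field.
    exact: h.
  ring.
have h1 : (1 - a) * S j.+1 n @[n --> \oo] --> (1 - a) * meixner_sum (ffact_poly R j.+1).
  by apply: cvgMr; exact: meixner_sum_cvg.
have h2 : (1 - a) * S j.+1 n @[n --> \oo] -->
    a * (c + j%:R) * meixner_sum (ffact_poly R j) - 0.
  rewrite (funext rec); apply: cvgB.
    by apply: cvgMr; exact: meixner_sum_cvg.
  apply: subexp_geometric_cvg0 => //; apply: subexpM; first exact: subexp_nat.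
  apply: subexpM; first exact: subexp_meixner_coef.
  apply: subexp_le (subexp_poly (ffact_poly R j \Po ('X - 1%:P))) => n.
  by rewrite horner_comp hornerXsubC.
by rewrite (cvg_unique _ h1 h2) // subr0.
Qed.

Let a_neq1 : 1 - a != 0.
Proof. by apply: contraTneq a_lt1 => /subr0_eq <-; rewrite normr1 ltxx. Qed.

(** On falling factorials the series and L obey the same first-order recursion, so they agree up to
    the value at 1. *)
Lemma meixner_sumE (L : {poly R} -> R) : functional L ->
  (forall j, L (ffact_poly R j) = a ^+ j * pochhammer c j / (1 - a) ^+ j) ->
  forall p, meixner_sum p = meixner_sum 1 * L p.
Proof.
move=> linL Lffact; suff h n : meixner_sum (ffact_poly R n) =
    meixner_sum 1 * L (ffact_poly R n).
  exact: (eq_functional meixner_sum_functional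
    (functional_scale linL (meixner_sum 1)) (@size_ffact_poly R) h).
rewrite Lffact; elim: n => [|n IH].
  by rewrite /ffact_poly big_ord0 pochhammer0 !expr0 mulr1 divr1 mulr1.
apply: (mulfI a_neq1); rewrite meixner_sum_ffact IH pochhammerS !exprS.
have : (1 - a) ^+ n != 0 by rewrite expf_neq0.
by move: ((1 - a) ^+ n) (a ^+ n) => u v u0; field; rewrite u0 a_neq1.
Qed.

Lemma meixner_sum_ge0 b (p : {poly R}) :
  (forall s : nat, 0 <= b * w s * p.[s%:R]) -> 0 <= b * meixner_sum p.
Proof.
move=> h; have cv : b * series (fun s => w s * p.[s%:R]) n @[n --> \oo] --> b * meixner_sum p.
  by apply: cvgMr; exact: meixner_sum_cvg.
rewrite -(cvg_lim _ cv) //; apply: limr_ge; first by apply/cvg_ex; eexists; exact: cv.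
apply: nearW => n; rewrite /series /= mulr_sumr; apply: sumr_ge0 => i _.
by rewrite mulrA.
Qed.

End MeixnerSeries.

Section MeixnerSumPositive.
Variables (R : realType) (a : R).
Hypothesis a01 : 0 < a < 1.

Let a_lt1 : `|a| < 1.
Proof. by move/andP: a01 => [a0 a1]; rewrite gtr0_norm. Qed.

Let meixner_sum_pos c : 0 < c -> 0 < meixner_sum a c 1.
Proof.
move=> c0; have /andP[a0 _] := a01.
rewrite (lt_le_trans ltr01) //; apply: limr_ge.
  exact: meixner_series_cvg.
exists 1%N => // n /= n0; rewrite /series /= -(prednK n0) big_nat_recl //=.
rewrite /meixner_weight expr0 pochhammer0 divr1 mul1r hornerC mul1r lerDl.
apply: sumr_ge0 => i _; rewrite hornerC mulr1 !mulr_ge0 ?exprn_ge0 ?invr_ge0 ?ltW //.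
exact: pochhammer_gt0.
Qed.

(* The binomial series: [meixner_sum a c 1 = (1 - a)^(-c)]. *)
Let meixner_sum_shift c : (forall n : nat, c != - n%:R) ->
  meixner_sum a c 1 = (1 - a) * meixner_sum a (c + 1) 1.
Proof.
move=> hc; pose S c n := series (fun s => meixner_weight a c s * (1 : {poly R}).[s%:R]) n.
have rec n : S c n.+1 = S (c + 1) n.+1 - a * S (c + 1) n.
  rewrite /S /series /= big_nat_recl // [in RHS]big_nat_recl //.
  rewrite -addrA; congr (_ + _).
    by rewrite /meixner_weight !expr0 !pochhammer0.
  rewrite mulr_sumr -sumrB; apply: eq_bigr => i _.
  rewrite !hornerC !mulr1 /meixner_weight exprS pochhammerSl pochhammerS.
  rewrite factS natrM invfM -natr1.
  have : i%:R + 1 != 0 :> R by rewrite natr1.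
  have : i`!%:R != 0 :> R by rewrite pnatr_eq0 -lt0n fact_gt0.
  move: (i`!%:R : R) (a ^+ i) (pochhammer (c + 1) i) => f u p f0 i0.
  by field; rewrite f0 i0.
have h1 : S c n.+1 @[n --> \oo] --> meixner_sum a c 1.
  by have := @meixner_sum_cvg _ _ c a_lt1 1; rewrite -cvg_shiftS.
have h2 : S c n.+1 @[n --> \oo] --> meixner_sum a (c + 1) 1 - a * meixner_sum a (c + 1) 1.
  rewrite (funext rec); apply: cvgB.
    by have := @meixner_sum_cvg _ _ (c + 1) a_lt1 1; rewrite -cvg_shiftS.
  by apply: cvgMr; exact: meixner_sum_cvg.
by rewrite (cvg_unique _ h1 h2) // mulrBl mul1r.
Qed.

(** For c < 0 the terms may have mixed signs; raising c by one costs a positive factor 1 - a, and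
    repeating this makes c positive. *)
Lemma meixner_sum_gt0 c : (forall n : nat, c != - n%:R) -> 0 < meixner_sum a c 1.
Proof.
move=> hc; have /andP[a0 a1] := a01.
have [m hm] : exists m : nat, 0 < c + m%:R.
  exists (hat c); exact: addr_hat_gt0.
elim: m c hc hm => [|m IH] c hc hm; first by apply: meixner_sum_pos; rewrite addr0 in hm.
rewrite meixner_sum_shift // mulr_gt0 ?subr_gt0 // IH //; first exact: neq_oppnS.
by rewrite -addrA addrC [1 + _]addrC natr1 addrC.
Qed.

End MeixnerSumPositive.

(** * Positivity *)

Lemma dual_meixner_sym (R : realType) (a c : R) (x s : nat) :
  (dual_meixner a c x).[s%:R] = (dual_meixner a c s).[x%:R].
Proof.
have E (m n : nat) : (dual_meixner a c m).[n%:R] = \sum_(i < (m + n).+1)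
    'C(m, i)%:R * ((a - 1) / a) ^+ i / pochhammer c i * ('C(n, i)%:R * i`!%:R).
  rewrite /dual_meixner horner_sum.
  rewrite -(@sum_ord_trunc _ (fun i => (dual_meixner_coef a c m i *: ffact_poly R i).[n%:R])
    m.+1 (m + n).+1) ?ltnS ?leq_addr //; last first.
    by move=> i h; rewrite hornerZ /dual_meixner_coef bin_small // !mul0r.
  apply: eq_bigr => i _; rewrite hornerZ horner_ffact_poly_nat /dual_meixner_coef.
  by rewrite -natrM bin_ffact.
by rewrite !E addnC; apply: eq_bigr => i _; ring.
Qed.

Lemma pochhammer1 (R : realType) n : pochhammer (1 : R) n = n`!%:R.
Proof.
elim: n => [|n IH]; first by rewrite pochhammer0.
by rewrite pochhammerS IH factS natrM mulrC nat1r.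
Qed.

(** * Positive functionals versus nonnegative weights *)

Section PositiveFunctional.
Variables (R : realType) (a c : R).
Hypothesis a01 : 0 < a < 1.
Hypothesis c_reg : forall n : nat, c != - n%:R.
Variable L : {poly R} -> R.
Hypothesis linL : functional L.
Hypothesis Lffact : forall j,
  L (ffact_poly R j) = a ^+ j * pochhammer c j / (1 - a) ^+ j.
Variables (b : R) (rho : {poly R}).

Let a_gt0 : 0 < a. Proof. by case/andP: a01. Qed.
Let a_lt1 : a < 1. Proof. by case/andP: a01. Qed.
Let norm_a_lt1 : `|a| < 1. Proof. by rewrite gtr0_norm. Qed.

Lemma weight_ge0_functional_ge0 (p : {poly R}) :
  (forall s : nat, 0 <= b * meixner_weight a c s * p.[s%:R]) -> 0 <= b * L p.
Proof.
move=> /(meixner_sum_ge0 norm_a_lt1).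
rewrite (meixner_sumE norm_a_lt1 linL Lffact) mulrCA pmulr_rge0 //.
exact: meixner_sum_gt0.
Qed.

Section Converse.
Hypothesis rho_ge0 : forall p : {poly R}, 0 <= b * L (rho * (p * p)).
Variable s0 : nat.

(* The weight a'^s is of Meixner type with c = 1 and dominates b w rho. *)
Let a' := (1 + a) / 2.
Let a'_gta : a < a'. Proof. by rewrite /a' ltr_pdivlMr //; have := a_lt1; lra. Qed.
Let a'_lt1 : a' < 1. Proof. by rewrite /a' ltr_pdivrMr //; have := a_lt1; lra. Qed.
Let a'_gt0 : 0 < a'. Proof. exact: lt_trans a'_gta. Qed.
Let norm_a' : `|a'| < 1. Proof. by rewrite gtr0_norm. Qed.
Let a'_neq0 : a' != 0. Proof. exact: lt0r_neq0. Qed.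
Let a'_neq1 : a' != 1. Proof. by rewrite lt_eqF. Qed.
Let one_reg (n : nat) : (1 : R) != - n%:R.
Proof. by rewrite -addr_eq0 nat1r. Qed.

Let weight1 s : meixner_weight a' 1 s = a' ^+ s.
Proof. by rewrite /meixner_weight pochhammer1 divff ?mulr1. Qed.

(** Apart from a^s the weight is subexponential, and a' / a > 1 is an admissible rate. *)
Let dominated : exists C, forall s : nat,
  `|b * meixner_weight a c s * rho.[s%:R]| <= C * a' ^+ s.
Proof.
have sv : subexp (fun s => b * (pochhammer c s / s`!%:R) * rho.[s%:R]).
  apply: subexpM; last exact: subexp_poly.
  by apply: subexpM; [exact: subexp_cst|exact: subexp_meixner_coef].
have q1 : 1 < a' / a by rewrite ltr_pdivlMr // mul1r.
have [C hC] := sv _ q1; exists C => s.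
have -> : b * meixner_weight a c s * rho.[s%:R] =
   a ^+ s * (b * (pochhammer c s / s`!%:R) * rho.[s%:R]).
  by rewrite /meixner_weight; ring.
have as0 : 0 < a ^+ s by rewrite exprn_gt0.
rewrite normrM (gtr0_norm as0) mulrC -ler_pdivlMr //.
by rewrite -[leRHS]mulrA -expr_div_n.
Qed.

Let P := dual_meixner a' 1.

(** As P_x has squared norm Z / a'^x, this is Z times the reproducing kernel at s0 for degrees below
    N. *)
Let kernel N : {poly R} := \sum_(x < N) (a' ^+ x * (P x).[s0%:R]) *: P x.
Let kappa N := \sum_(x < N) a' ^+ x * (P x).[s0%:R] ^+ 2.

Let horner_kernel N : (kernel N).[s0%:R] = kappa N.
Proof.
by rewrite /kernel horner_sum; apply: eq_bigr => x _; rewrite hornerZ expr2 mulrA.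
Qed.

Let size_kernel N : (size (kernel N) <= N)%N.
Proof.
apply: (leq_trans (size_sum _ _ _)); apply/bigmax_leqP => x _.
by rewrite (leq_trans (size_scale_leq _ _)) // size_dual_meixner.
Qed.

Let Z := meixner_sum a' 1 1.

Let Z_gt0 : 0 < Z.
Proof. by apply: meixner_sum_gt0 one_reg; rewrite a'_gt0. Qed.

Let sum_norm x : meixner_sum a' 1 (P x * P x) = Z / a' ^+ x.
Proof.
have [L' linL' hL'] := exists_dual_meixner_functional a' (1 : R).
rewrite (meixner_sumE norm_a' linL' hL').
rewrite (dual_meixner_norm a'_neq0 a'_neq1 one_reg linL' hL') pochhammer1 -/Z.
have : a' ^+ x != 0 by rewrite expf_neq0.
by move: (a' ^+ x) => u u0; field; rewrite u0 pnatr_eq0 -lt0n fact_gt0.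
Qed.

Let sum_kernel N : meixner_sum a' 1 (kernel N * kernel N) = Z * kappa N.
Proof.
have linS := meixner_sum_functional 1 norm_a'.
have orth n (r : {poly R}) : (size r <= n)%N -> meixner_sum a' 1 (P n * r) = 0.
  have [L' linL' hL'] := exists_dual_meixner_functional a' (1 : R).
  move=> sr; rewrite (meixner_sumE norm_a' linL' hL').
  by rewrite (dual_meixner_orth a'_neq0 a'_neq1 one_reg linL' hL') // mulr0.
elim: N => [|N IH].
  by rewrite /kernel /kappa !big_ord0 mul0r functional0 // mulr0.
have -> : kernel N.+1 = kernel N + (a' ^+ N * (P N).[s0%:R]) *: P N.
  by rewrite /kernel big_ord_recr.
have -> : kappa N.+1 = kappa N + a' ^+ N * (P N).[s0%:R] ^+ 2.
  by rewrite /kappa big_ord_recr.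
move: (kernel N) (size_kernel N) IH => k sk IH; set rhs := RHS.
rewrite mulrDl !mulrDr -!scalerAl -!scalerAr !functionalD // !functionalZ //.
rewrite IH [k * P N]mulrC orth // sum_norm.
have : a' ^+ N != 0 by rewrite expf_neq0.
by rewrite /rhs; move: (a' ^+ N) => u u0; field.
Qed.

(** By self-duality P_x(s0) = P_{s0}(x), so kappa is a partial sum of the squared norm of P_{s0}. At
    this limit the single term a'^s0 kappa^2 fills the whole sum Z kappa: the kernel concentrates at
    s0. *)
Let kappa_cvg : kappa N @[N --> \oo] --> Z / a' ^+ s0.
Proof.
rewrite -sum_norm.
have -> : kappa = series (fun s => meixner_weight a' 1 s * (P s0 * P s0).[s%:R]).
  apply/funext => N; rewrite /series /= big_mkord; apply: eq_bigr => x _.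
  by rewrite weight1 hornerM expr2 /P dual_meixner_sym.
exact: meixner_sum_cvg.
Qed.

(** The weight C a'^s - b w rho is nonnegative everywhere, so its term at s0 is at most the full sum
    against the squared kernel; there the part with b w rho is nonnegative and is dropped. *)
Let kernel_ineq C N : (forall s : nat,
    `|b * meixner_weight a c s * rho.[s%:R]| <= C * a' ^+ s) ->
  (C * a' ^+ s0 - b * meixner_weight a c s0 * rho.[s0%:R]) * kappa N ^+ 2 <=
  C * (Z * kappa N).
Proof.
move=> hC; have [p horner_p sum_p] : exists2 p : {poly R},
    p.[s0%:R] = kappa N & meixner_sum a' 1 (p * p) = Z * kappa N.
  by exists (kernel N).
pose h (s : nat) := (C * a' ^+ s - b * meixner_weight a c s * rho.[s%:R]) * p.[s%:R] ^+ 2.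
have h0 s : 0 <= h s.
  rewrite mulr_ge0 ?sqr_ge0 // subr_ge0 (le_trans _ (hC s)) //.
  exact: ler_norm.
have cv : series h n @[n --> \oo] --> C * (Z * kappa N) -
    b * meixner_sum a c (rho * (p * p)).
  have -> : series h = (fun n =>
      C * series (fun s => meixner_weight a' 1 s * (p * p).[s%:R]) n -
      b * series (fun s => meixner_weight a c s * (rho * (p * p)).[s%:R]) n).
    apply/funext => n; rewrite /series /= !mulr_sumr -sumrB.
    by apply: eq_bigr => s _ /=; rewrite weight1 !hornerM /h; ring.
  rewrite -sum_p.
  by apply: cvgB; apply: cvgMr; exact: meixner_sum_cvg.
have T0 : 0 <= b * meixner_sum a c (rho * (p * p)).
  rewrite (meixner_sumE norm_a_lt1 linL Lffact) mulrCA mulr_ge0 // ltW //.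
  exact: meixner_sum_gt0.
have : h s0 <= C * (Z * kappa N) - b * meixner_sum a c (rho * (p * p)).
  rewrite -(cvg_lim _ cv) //; apply: limr_ge; first by apply/cvg_ex; eexists; exact: cv.
  exists s0.+1 => // n /= ltn; rewrite /series /= big_mkord.
  rewrite (bigD1 (Ordinal ltn)) //= lerDl; apply: sumr_ge0 => i _; exact: h0.
rewrite /h horner_p => /le_trans; apply.
by rewrite gerBl.
Qed.

Lemma functional_ge0_weight_ge0 : 0 <= b * meixner_weight a c s0 * rho.[s0%:R].
Proof.
have [C hC] := dominated; set g := b * _ * _.
have u0 : 0 < a' ^+ s0 by rewrite exprn_gt0.
pose k := Z / a' ^+ s0; have k0 : 0 < k by rewrite divr_gt0.
have h1 : (C * a' ^+ s0 - g) * kappa N ^+ 2 @[N --> \oo] --> (C * a' ^+ s0 - g) * k ^+ 2.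
  by apply: cvgMr; rewrite expr2; apply: cvgM; exact: kappa_cvg.
have h2 : C * (Z * kappa N) @[N --> \oo] --> C * (Z * k).
  by do 2 apply: cvgMr; exact: kappa_cvg.
have : (C * a' ^+ s0 - g) * k ^+ 2 <= C * (Z * k).
  apply: (ler_cvg_to h1 h2); apply: nearW => N; exact: kernel_ineq.
(* Since Z = a'^s0 k, the terms with C cancel in the limit and only -g k^2 <= 0 remains. *)
have -> : C * (Z * k) = C * a' ^+ s0 * k ^+ 2.
  rewrite /k; move: (a' ^+ s0) u0 => u u0; field; exact: lt0r_neq0.
rewrite mulrBl gerBl pmulr_lge0 // exprn_gt0 //.
Qed.

End Converse.
End PositiveFunctional.

Section ExceptionalPositivity.
Variables (R : realType) (a c : R) (F1 F2 : {fset nat}).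
Hypothesis a01 : 0 < a < 1.
Hypothesis c_reg : forall n : nat, c != - n%:R.
Hypothesis Omega_neq0 : forall n : nat, OmegaF a c F1 F2 n%:R != 0.

Let a_gt0 : 0 < a. Proof. by case/andP: a01. Qed.
Let a_neq0 : a != 0. Proof. exact: lt0r_neq0. Qed.
Let a_neq1 : a != 1. Proof. by case/andP: a01 => _ h; rewrite lt_eqF. Qed.

Local Notation rho := (christoffel_weight (row_nodes c F1 F2)).

Let rhoE (s : nat) : rho.[s%:R] = \prod_(f <- enum_fset F1) (s%:R - f%:R) *
  \prod_(f <- enum_fset F2) (s%:R + c + f%:R).
Proof.
rewrite horner_christoffel_weight /row_nodes /row_labels big_map big_cat !big_map.
rewrite !(perm_big _ (permEl (perm_sort _ _))) /=; congr (_ * _).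
by apply: eq_bigr => f _; rewrite /row_node /=; ring.
Qed.

Lemma massF_ge0_admissible :
  (forall x, 0 <= massF a c F1 F2 x) <-> admissible c F1 F2.
Proof.
have [L linL Lffact] := exists_dual_meixner_functional a c.
have GD n := GammaD n c_reg.
pose q := christoffel_quo (dual_meixner a c) (row_nodes c F1 F2).
have massE x : (0 <= massF a c F1 F2 x) = (0 <= Gamma c * L (rho * (q x * q x))).
  exact: massF_ge0.
have wE (s : nat) : (0 <= Gamma c * meixner_weight a c s * rho.[s%:R]) =
    (0 <= Gamma c * pochhammer c s * rho.[s%:R]).
  have p0 : 0 < a ^+ s / s`!%:R by rewrite divr_gt0 ?exprn_gt0 // ltr0n fact_gt0.
  rewrite -[RHS](pmulr_lge0 _ p0) /meixner_weight; congr (0 <= _); ring.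
rewrite admissibleE //; split => [h s|h x].
  rewrite -rhoE -wE; apply: (functional_ge0_weight_ge0 a01 c_reg linL Lffact).
  (* The masses give the sign of this form on its orthogonal basis only; the converse needs it on
     all squares. *)
  apply: (orth_sqr_ge0 (functional_scale (functional_mul linL rho) (Gamma c)) (q := q)).
  - exact: size_exceptional_quo.
  - move=> n r sr.
    by rewrite (exceptional_quo_orth F1 F2 a_neq0 a_neq1 c_reg linL Lffact) ?mulr0.
  - by move=> n; rewrite -massE.
rewrite massE; apply: (weight_ge0_functional_ge0 a01 c_reg linL Lffact) => s.
rewrite [_.[_]]hornerM hornerM -expr2 mulrA mulr_ge0 ?sqr_ge0 //.
by rewrite wE rhoE.
Qed.

End ExceptionalPositivity.

(** * Signed discrete measures *)

Section SignedDiscreteIntegral.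
Variables (R : realType).
Implicit Types (w : nat -> R) (f : R -> R).
Local Notation T := (measurableTypeR R).

Let pos w x : R := Num.max (w x) 0.

Let pos_ge0 (x : R) : 0 <= Num.max x 0.
Proof. by rewrite le_max lexx orbT. Qed.

Let pos_le (x : R) : Num.max x 0 <= `|x|.
Proof. by rewrite ge_max ler_norm normr_ge0. Qed.

Let pos_neg (x : R) : Num.max x 0 - Num.max (- x) 0 = x.
Proof.
have /orP[x0|x0] := le_total 0 x.
  by rewrite max_l // max_r ?oppr_le0 // subr0.
by rewrite max_r // max_l ?oppr_ge0 // sub0r opprK.
Qed.

Lemma dpos_integral w (f : T -> \bar R) : measurable_fun [set: T] f ->
  (forall x, (0 <= f x)%E) ->
  (\int[dpos w]_(x in [set: T]) f x =
   \sum_(0 <= x <oo) (Num.max (w x) 0)%:E * f x%:R)%E.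
Proof.
move=> mf f0; rewrite /dpos ge0_integral_measure_series //.
apply: eq_eseriesr => x _; rewrite ge0_integral_mscale //=.
by rewrite integral_dirac //= diracT mul1e.
Qed.

Lemma eseries_EFin (u : nat -> R) : cvgn (series u) ->
  (\sum_(0 <= x <oo) (u x)%:E)%E = (limn (series u))%:E.
Proof.
move=> cu; rewrite -EFin_lim //; congr (limn _).
by apply/funext => n /=; rewrite sumEFin.
Qed.

Let dominated_cvg (u v : nat -> R) : (forall n, 0 <= u n <= `|v n|) ->
  cvgn (series (fun n => `|v n|)) -> cvgn (series u).
Proof.
by move=> uv; apply: series_le_cvg => n //; case/andP: (uv n).
Qed.

Let dpos_integral_EFin w (f g : T -> R) : measurable_fun [set: T] (EFin \o f) ->
  (forall x, 0 <= f x <= `|g x|) -> cvgn (series (fun x => `|w x * g x%:R|)) ->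
  (\int[dpos w]_(x in [set: T]) (f x)%:E =
   (limn (series (fun x => pos w x * f x%:R)))%:E)%E.
Proof.
move=> mf fg cw; rewrite dpos_integral //; last first.
  by move=> x; rewrite lee_fin; case/andP: (fg x).
rewrite -eseries_EFin //; apply: dominated_cvg cw => n.
have /andP[f0 fg'] := fg n%:R.
by rewrite mulr_ge0 ?pos_ge0 //= normrM ler_pM ?pos_ge0 ?pos_le.
Qed.

Lemma dpos_integrable w (f : T -> R) : measurable_fun [set: T] (EFin \o f) ->
  cvgn (series (fun x => `|w x * f x%:R|)) ->
  (dpos w).-integrable [set: T] (EFin \o f).
Proof.
move=> mf cw; apply/integrableP; split => //.
have -> : (\int[dpos w]_(x in [set: T]) `|(EFin \o f) x|)%E =
    (\int[dpos w]_(x in [set: T]) (`|f x|)%:E)%E by [].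
rewrite (dpos_integral_EFin (g := f)) ?ltry // => [|x]; last by rewrite normr_ge0 lexx.
have -> : EFin \o (fun x => `|f x|) = abse \o (EFin \o f) by [].
exact: measurableT_comp.
Qed.

Lemma dpos_Rintegral w (f : T -> R) : measurable_fun [set: T] (EFin \o f) ->
  cvgn (series (fun x => `|w x * f x%:R|)) ->
  \int[dpos w]_(x in [set: T]) f x = limn (series (fun x => pos w x * f x%:R)).
Proof.
move=> mf cw; rewrite /Rintegral integralE.
have -> : (\int[dpos w]_(x in [set: T]) (fun x => (f x)%:E)^\+ x)%E =
    (\int[dpos w]_(x in [set: T]) (Num.max (f x) 0)%:E)%E.
  by apply: eq_integral => x _; rewrite funeposE -EFin_max.
have -> : (\int[dpos w]_(x in [set: T]) (fun x => (f x)%:E)^\- x)%E =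
    (\int[dpos w]_(x in [set: T]) (Num.max (- f x) 0)%:E)%E.
  by apply: eq_integral => x _; rewrite funenegE -EFinN -EFin_max.
have mp : measurable_fun [set: T] (EFin \o (fun x => Num.max (f x) 0)).
  have -> : EFin \o (fun x => Num.max (f x) 0) = (EFin \o f)^\+%E.
    by apply/funext => x; rewrite funeposE -EFin_max.
  exact: measurable_funepos.
have mn : measurable_fun [set: T] (EFin \o (fun x => Num.max (- f x) 0)).
  have -> : EFin \o (fun x => Num.max (- f x) 0) = (EFin \o f)^\-%E.
    by apply/funext => x; rewrite funenegE -EFinN -EFin_max.
  exact: measurable_funeneg.
have dp x : 0 <= Num.max (f x) 0 <= `|f x| by rewrite pos_ge0 pos_le.
have dn x : 0 <= Num.max (- f x) 0 <= `|f x| by rewrite pos_ge0 -normrN pos_le.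
rewrite (dpos_integral_EFin mp dp cw) (dpos_integral_EFin mn dn cw) -EFinB /=.
rewrite -lim_seriesB; first last.
- apply: dominated_cvg cw => n; have /andP[h1 h2] := dn n%:R.
  by rewrite mulr_ge0 ?pos_ge0 //= normrM ler_pM ?pos_ge0 ?pos_le.
- apply: dominated_cvg cw => n; have /andP[h1 h2] := dp n%:R.
  by rewrite mulr_ge0 ?pos_ge0 //= normrM ler_pM ?pos_ge0 ?pos_le.
congr (limn (series _)); apply/funext => x.
rewrite !fctE -mulrBr; congr (_ * _); exact: pos_neg.
Qed.

Let neg_cvg w f : cvgn (series (fun x => `|w x * f x%:R|)) ->
  cvgn (series (fun x => `|- w x * f x%:R|)).
Proof.
by have -> : (fun x => `|- w x * f x%:R|) = (fun x => `|w x * f x%:R|)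
  by apply/funext => x; rewrite mulNr normrN.
Qed.

Lemma dsigned_integrable w (f : T -> R) : measurable_fun [set: T] (EFin \o f) ->
  cvgn (series (fun x => `|w x * f x%:R|)) -> dintegrable w f.
Proof.
move=> mf cw; split; first exact: dpos_integrable.
by apply: (@dpos_integrable (fun x => - w x)) => //; exact: neg_cvg.
Qed.

Lemma dintegralE w (f : T -> R) : measurable_fun [set: T] (EFin \o f) ->
  cvgn (series (fun x => `|w x * f x%:R|)) ->
  dintegral w f = limn (series (fun x => w x * f x%:R)).
Proof.
move=> mf cw; rewrite /dintegral dpos_Rintegral //.
rewrite [X in _ - X](@dpos_Rintegral (fun x => - w x) f mf (neg_cvg cw)).
have C (v : nat -> R) : (forall x, `|v x| <= `|w x|) ->
    cvgn (series (fun x => v x * f x%:R)).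
  move=> vw; apply: normed_cvg; apply: dominated_cvg cw => n.
  by rewrite normr_ge0 /= !normrM ler_wpM2r.
rewrite -lim_seriesB; first last.
- by apply: C => x; rewrite ger0_norm ?pos_ge0 // -normrN pos_le.
- by apply: C => x; rewrite ger0_norm ?pos_ge0 // pos_le.
congr (limn (series _)); apply/funext => x.
by rewrite !fctE -mulrBl; congr (_ * _); exact: pos_neg.
Qed.

Lemma dsigned_finite w : cvgn (series (fun x => `|w x|)) -> dfinite w.
Proof.
have E (v : nat -> R) : cvgn (series (fun x => `|v x|)) -> (dpos v [set: T] < +oo)%E.
  move=> cv; rewrite -[ltLHS]mul1e -integral_cst //.
  rewrite dpos_integral //.
  have -> : (\sum_(0 <= x <oo) (Num.max (v x) 0)%:E * cst 1 (x%:R : T))%E =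
      (\sum_(0 <= x <oo) (Num.max (v x) 0)%:E)%E.
    by apply: eq_eseriesr => x _; rewrite mule1.
  rewrite eseries_EFin ?ltry //; apply: dominated_cvg cv => n.
  by rewrite pos_ge0 pos_le.
move=> cw; split; first exact: E.
apply: (E (fun x => - w x)).
by have -> : (fun x => `|- w x|) = (fun x => `|w x|) by apply/funext => x; rewrite normrN.
Qed.

Let dposE w (A : set T) :
  dpos w A = (\sum_(0 <= x <oo) (Num.max (w x) 0)%:E * \d_(x%:R : T) A)%E.
Proof. by []. Qed.

Let dpos_eq0 w (A : set T) : (forall x, x%:R \in A -> w x <= 0) -> dpos w A = 0%E.
Proof.
move=> h; rewrite dposE eseries0 // => x _ _; rewrite diracE.
case: (boolP (_ \in A)) => [/h wx|_]; last by rewrite mule0.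
by rewrite max_r // mul0e.
Qed.

Lemma dsigned_positive w :
  positive_set (dsigned w) [set: T] <-> forall x, 0 <= w x.
Proof.
split => [[_ h] y|h]; last first.
  split => // A _ _; rewrite /dsigned (_ : dneg w A = 0%E) ?sube0 //.
  by apply: (@dpos_eq0 (fun x => - w x)) => x _; rewrite oppr_le0.
rewrite leNgt; apply/negP => wy.
(* The singleton isolates a negative mass: the positive part vanishes on it. *)
pose A : set T := [set y%:R].
have pA : dpos w A = 0%E.
  by apply: dpos_eq0 => x; rewrite inE /A /= => /eqP; rewrite eqr_nat => /eqP->; exact: ltW.
have nA : ((- w y)%:E <= dneg w A)%E.
  rewrite (_ : dneg w A = dpos (fun x => - w x) A) // dposE.
  apply: le_trans (nneseries_lim_ge y.+1 _) => [|x _]; last first.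
    by rewrite mule_ge0 ?lee_fin ?pos_ge0.
  rewrite big_nat_recr //= diracE mem_set // mule1 max_l ?oppr_ge0 ?(ltW wy) //.
  by rewrite leeDr // sume_ge0 // => x _; rewrite mule_ge0 ?lee_fin ?pos_ge0.
have := h A (measurable_set1 _) (@subsetT _ _).
rewrite /dsigned pA sub0e leeNr oppe0 => /(le_trans nA).
by rewrite lee_fin oppr_le0 leNgt wy.
Qed.

End SignedDiscreteIntegral.

(** * The exceptional measure: summability, orthogonality, negative a *)

Section ExceptionalMeasure.
Variables (R : realType) (a c : R) (F1 F2 : {fset nat}).
Hypotheses (a_lt1 : `|a| < 1) (a_neq0 : a != 0).
Hypothesis c_reg : forall n : nat, c != - n%:R.
Hypothesis Omega_neq0 : forall n : nat, OmegaF a c F1 F2 n%:R != 0.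

Local Notation k := (nF F1 F2).

Let massE x : massF a c F1 F2 x = a ^+ x * (Gamma c * (pochhammer c (x + k) / x`!%:R) *
  (OmegaF a c F1 F2 x%:R)^-1 * (OmegaF a c F1 F2 x.+1%:R)^-1).
Proof.
rewrite /massF natr1; have -> : x%:R + c + k%:R = c + (x + k)%:R by rewrite natrD; ring.
by rewrite GammaD // !invfM; ring.
Qed.

Let subexp_invOmega : subexp (fun x => (OmegaF a c F1 F2 x%:R)^-1).
Proof.
have [e e0 he] := polyfun_bounded_below (polyfun_OmegaF a c F1 F2) Omega_neq0.
exact: subexp_inv e0 he.
Qed.

Let subexp_invOmegaS : subexp (fun x => (OmegaF a c F1 F2 x.+1%:R)^-1).
Proof.
by have := subexp_shift 1 subexp_invOmega; apply: subexp_le => n; rewrite addn1.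
Qed.

Lemma massF_summable f : polyfun f ->
  cvgn (series (fun x => `|massF a c F1 F2 x * f x%:R|)).
Proof.
move=> pf; have sv : subexp (fun x => Gamma c * (pochhammer c (x + k) / x`!%:R) *
    (OmegaF a c F1 F2 x%:R)^-1 * (OmegaF a c F1 F2 x.+1%:R)^-1 * f x%:R).
  apply: subexpM; last exact: subexp_polyfun.
  apply: subexpM; last exact: subexp_invOmegaS.
  apply: subexpM; last exact: subexp_invOmega.
  by apply: subexpM; [exact: subexp_cst|exact: subexp_pochhammer].
rewrite (_ : (fun x => `|massF a c F1 F2 x * f x%:R|) = (fun x => `|a ^+ x *
    (Gamma c * (pochhammer c (x + k) / x`!%:R) * (OmegaF a c F1 F2 x%:R)^-1 *
     (OmegaF a c F1 F2 x.+1%:R)^-1 * f x%:R)|)).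
  exact: subexp_geometric_norm_cvg.
by apply/funext => x; rewrite massE; congr (`|_|); ring.
Qed.

Lemma massF_finite : dfinite (massF a c F1 F2).
Proof.
apply: dsigned_finite; have := massF_summable (polyfun_cst 1).
rewrite (_ : (fun x => `|massF a c F1 F2 x * 1|) = fun x => `|massF a c F1 F2 x|) //.
by apply/funext => x; rewrite mulr1.
Qed.

Let polyfun_measurable f : polyfun f ->
  measurable_fun [set: measurableTypeR R] (EFin \o f).
Proof.
move=> pf; apply/measurable_EFinP; apply: continuous_measurable_fun.
exact: polyfun_continuous.
Qed.

Lemma massF_integrable f : polyfun f -> dintegrable (massF a c F1 F2) f.
Proof.
move=> pf; apply: dsigned_integrable; [exact: polyfun_measurable|exact: massF_summable].
Qed.

Lemma massF_integral f : polyfun f ->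
  dintegral (massF a c F1 F2) f = limn (series (fun x => massF a c F1 F2 x * f x%:R)).
Proof.
move=> pf; apply: dintegralE; [exact: polyfun_measurable|exact: massF_summable].
Qed.

Lemma meixnerF_orthogonal n r : (uF F1 F2 <= n)%N -> (uF F1 F2 <= r)%N -> n <> r ->
  dintegral (massF a c F1 F2)
    (fun x => meixnerF a c F1 F2 n x * meixnerF a c F1 F2 r x) = 0.
Proof.
move=> len ler nr.
have a1 : a != 1 by apply: contraTneq a_lt1 => ->; rewrite normr1 ltxx.
have pn := polyfun_meixnerF a c F1 F2 n; have pr := polyfun_meixnerF a c F1 F2 r.
rewrite massF_integral; last exact: polyfunM.
set u := fun x : nat => _.
have [L linL Lffact] := exists_dual_meixner_functional a c.
have [K hK] := massF_partial_sum a_neq0 a1 c_reg Omega_neq0 linL Lffact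
  (fun n => GammaD n c_reg) len ler nr.
apply/cvg_lim => //; rewrite -cvg_shiftS.
have sn := subexp_polyfun pn; have sr := subexp_polyfun pr.
have shS (v : nat -> R) : subexp v -> subexp (fun N => v N.+1).
  by move=> /(subexp_shift 1); apply: subexp_le => m; rewrite addn1.
(* The Christoffel-Darboux boundary term as a^N times a product of subexponential sequences. *)
have E N : series u N.+1 = a ^+ N * (K * (pochhammer c (N + k.+1) / N`!%:R *
    (OmegaF a c F1 F2 N.+1%:R)^-1 * (OmegaF a c F1 F2 N.+1%:R)^-1 *
    (meixnerF a c F1 F2 n N.+1%:R * meixnerF a c F1 F2 r N%:R +
     (-1) * (meixnerF a c F1 F2 n N%:R * meixnerF a c F1 F2 r N.+1%:R)))).
  rewrite /series /= big_mkord hK addSnnS.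
  by rewrite expr2 invfM; ring.
rewrite (funext E); apply: subexp_geometric_cvg0 => //.
apply: subexpM; first exact: subexp_cst.
apply: subexpM; last first.
  apply: subexpD; first exact: subexpM (shS _ sn) sr.
  by apply: subexpM; [exact: subexp_cst|exact: subexpM sn (shS _ sr)].
apply: subexpM; last exact: subexp_invOmegaS.
apply: subexpM; last exact: subexp_invOmegaS.
exact: subexp_pochhammer.
Qed.

Lemma massF_lt0 : a < 0 -> exists x, massF a c F1 F2 x < 0.
Proof.
move=> a0.
have [N hN] := polyfun_same_sign (polyfun_OmegaF a c F1 F2) Omega_neq0.
(* Odd, so a^x < 0; beyond N, so Omega(x) Omega(x + 1) > 0; beyond |c|, so Gamma has a positive
   argument. *)
pose M := Num.bound `|c|; pose x := (N + M).*2.+1; exists x.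
have leNx : (N <= x)%N by rewrite /x; lia.
have leMx : (M <= x)%N by rewrite /x; lia.
have ax : a ^+ x < 0.
  rewrite /x exprS -mul2n exprM nmulr_rlt0 // exprn_gt0 //.
  by rewrite lt0r sqrf_eq0 a_neq0 sqr_ge0.
have G0 : 0 < Gamma (c + (x + k)%:R).
  apply: Gamma_gt0; rewrite natrD addrA ltr_wpDr //.
  have : `|c| < x%:R by rewrite (lt_le_trans (archi_boundP _)) // ler_nat.
  by rewrite ltr_norml => /andP[+ _]; lra.
rewrite massE nmulr_rlt0 // mulrA -GammaD // -mulrA -invfM.
by rewrite divr_gt0 ?hN // divr_gt0 // ltr0n fact_gt0.
Qed.

End ExceptionalMeasure.

Theorem theorem4p3 (R : realType) (a c : R) (F1 F2 : {fset nat})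
  (ha1 : -1 < a) (ha2 : a < 1) (ha0 : a != 0)
  (hc : forall n : nat, c != - n%:R)
  (hF1 : forall f : nat, f \in F1 -> (0 < f)%N)
  (hF2 : forall f : nat, f \in F2 -> (0 < f)%N)
  (hF : ~ (F1 = fset0 /\ F2 = fset0))
  (hOmega : forall n : nat, OmegaF a c F1 F2 n%:R != 0) :
  [/\ dfinite (massF a c F1 F2),
      forall n r : nat, sigmaF F1 F2 n -> sigmaF F1 F2 r -> n <> r ->
        dintegrable (massF a c F1 F2)
          (fun x => meixnerF a c F1 F2 n x * meixnerF a c F1 F2 r x) /\
        dintegral (massF a c F1 F2)
          (fun x => meixnerF a c F1 F2 n x * meixnerF a c F1 F2 r x) = 0,
      a < 0 ->
        ~ positive_set (dsigned (massF a c F1 F2)) [set: measurableTypeR R]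
    & 0 < a ->
        (positive_set (dsigned (massF a c F1 F2)) [set: measurableTypeR R]
         <-> admissible c F1 F2)].
Proof.
have a_norm : `|a| < 1 by rewrite ltr_norml ha1 ha2.
split.
- exact: massF_finite.
- move=> n r /andP[len _] /andP[ler _] nr; split; last exact: meixnerF_orthogonal.
  by apply: massF_integrable => //; apply: polyfunM; exact: polyfun_meixnerF.
- move=> a0 /dsigned_positive mass_ge0.
  have [x] := massF_lt0 a_norm ha0 hc hOmega a0.
  by rewrite ltNge mass_ge0.
- move=> a0; have a01 : 0 < a < 1 by rewrite a0.
  have pos_adm := massF_ge0_admissible a01 hc hOmega.
  by split=> [/dsigned_positive/pos_adm|/pos_adm/dsigned_positive].
Qed.
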